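(* Let $u\in S_n$, $a\le k$ and $b\le n-k$. Then $$\mathfrak{S}_u(x)\cdot s_{(b,1^{a-1})}(x_1,\dots,x_k)\ =\ \sum\binom{s(\zeta)-1}{\mathrm{ht}(\zeta)-a}\,\mathfrak{S}_{\zeta u}(x)\,,$$ the sum over all minimal permutations $\zeta\in S_n$ such that $u\le_k\zeta u$ and $\mathcal{L}(\zeta)=a+b-1$.
   Context: Here $n,k,a,b$ are positive integers, $S_n$ is the symmetric group on $[n]=\{1,\dots,n\}$, and $x=\{x_1,\dots,x_n\}$. For $w\in S_n$, $\mathfrak{S}_w(x)\in\mathbb{Z}[x_1,\dots,x_n]$ is the Schubert polynomial of Lascoux and Schützenberger; it corresponds to the Schubert class $\mathfrak{S}_w$ in the integral cohomology ring $H^*\mathbb{F}\ell_n$ of the manifold of complete flags in $\mathbb{C}^n$ under Borel's isomorphism of $H^*\mathbb{F}\ell_n$ with the quotient of $\mathbb{Z}[x_1,\dots,x_n]$ by the ideal generated by the elementary symmetric polynomials $e_1,\dots,e_n$ in $x_1,\dots,x_n$. $s_\lambda(x_1,\dots,x_k)$ is the Schur polynomial, and $(b,1^{a-1})$ is the hook partition of $a+b-1$ into $a$ parts, the first of size $b$ and the remaining all of size $1$. A binomial coefficient $\binom{m}{j}$ is $0$ if $j<0$ or $j>m$. Permutations are composed as functions, $(i,j)$ is a transposition, and $\ell(u)=\#\{i<j\mid u(i)>u(j)\}$. The $k$-Bruhat order $\le_k$ on $S_n$ is the partial order with covers $u\lessdot_k u(i,j)$ whenever $1\le i\le k<j\le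 n$ and $\ell(u(i,j))=\ell(u)+1$. For $\zeta\in S_n$: $\mathrm{supp}(\zeta)=\{i\in[n]\mid\zeta(i)\neq i\}$; $\mathrm{ht}(\zeta)=\#\{i\in[n]\mid i<\zeta(i)\}$; $s(\zeta)$ is the number of nontrivial cycles in the factorization of $\zeta$ into disjoint cycles; and $\mathcal{L}(\zeta)=\ell(\zeta u)-\ell(u)$ for any $u\in S_n$ and $k$ with $u\le_k\zeta u$ (the value does not depend on the choice of $u$ and $k$). The permutation $\zeta$ is minimal if $\mathcal{L}(\zeta)=\#\mathrm{supp}(\zeta)-s(\zeta)$.
   Formalization: The identity is proved modulo the ideal (e_1,...,e_n), i.e. in the cohomology ring of the flag manifold; as an equality of polynomials with ζ in S_n it fails, e.g. n=2, k=a=b=1, u=(1,2), where it would say x_1^2=0. *)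

(* Defs.v *)
From mathcomp Require Import all_boot all_order all_algebra fingroup perm.
From mathcomp Require Export mpoly.

Set Implicit Arguments.
Unset Strict Implicit.
Unset Printing Implicit Defensive.

Import GRing.Theory.
Local Open Scope ring_scope.

(* The index set [n] is 'I_n, numbered from 0: position i of the mathematics
   is the ordinal i - 1, and "i <= k < j" becomes "i < k <= j". *)

(* Composition of functions, first v and then u.  The product of 'S_n is in
   the opposite order: (s * t)%g x = t (s x). *)
Definition permcomp (n : nat) (u v : 'S_n) : 'S_n := (v * u)%g.

Lemma permcompE (n : nat) (u v : 'S_n) (i : 'I_n) : permcomp u v i = u (v i).
Proof. exact: permM. Qed.

Definition plength (n : nat) (u : 'S_n) : nat :=
  #|[set p : 'I_n * 'I_n | (p.1 < p.2)%N && (u p.2 < u p.1)%N]|.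

(** * The k-Bruhat order *)

Definition kcover (n k : nat) : rel 'S_n := fun u v =>
  [exists i : 'I_n, exists j : 'I_n,
    [&& (i < k)%N, (k <= j)%N, v == permcomp u (tperm i j)
      & plength v == (plength u).+1]].

Definition kbruhat (n k : nat) : rel 'S_n := connect (@kcover n k).

(** * Statistics of a permutation *)

Definition psupp (n : nat) (z : 'S_n) : {set 'I_n} := [set i | z i != i].

Definition pht (n : nat) (z : 'S_n) : nat := #|[set i : 'I_n | (i < z i)%N]|.

Definition pcycles (n : nat) (z : 'S_n) : nat :=
  #|[set c in porbits z | (1 < #|c|)%N]|.

(* The common value of plength (z u) - plength u over all pairs (u, k) with
   u <=_k z u, read off at one such pair; the subtraction is a genuine one as
   plength is monotone for <=_k.  Such a pair exists for every z, so that the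
   default value is never used. *)
Definition kheight (n : nat) (z : 'S_n) : nat :=
  if [pick p : 'S_n * 'I_n.+1 | kbruhat p.2 p.1 (permcomp z p.1)] is Some p
  then (plength (permcomp z p.1) - plength p.1)%N else 0%N.

Definition pminimal (n : nat) (z : 'S_n) : bool :=
  kheight z == (#|psupp z| - pcycles z)%N.

Definition binz (m : nat) (j : int) : nat :=
  if j is Posz i then binomial m i else 0%N.

(** * Divided differences and Schubert polynomials *)

Lemma divdiff_subproof (n : nat) (i j : 'I_n) (f : {mpoly int[n]}) :
  exists g : {mpoly int[n]}, ('X_i - 'X_j) * g == f - msym (tperm i j) f.
Proof.
pose D (h : {mpoly int[n]}) :=
  exists g : {mpoly int[n]}, ('X_i - 'X_j) * g = h - msym (tperm i j) h.
suff [g hg] : D f by exists g; apply/eqP.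
have D0 : D 0 by exists 0; rewrite mulr0 raddf0 subrr.
have DD p q : D p -> D q -> D (p + q).
  move=> [gp hp] [gq hq]; exists (gp + gq).
  by rewrite mulrDr hp hq raddfD opprD addrACA.
have DZ c p : D p -> D (c *: p).
  by move=> [g hg]; exists (c *: g); rewrite -scalerAr hg msymZ scalerBr.
have D1 : D 1 by exists 0; rewrite mulr0 msym1 subrr.
have DM p q : D p -> D q -> D (p * q).
  move=> [gp hp] [gq hq]; exists (gp * q + msym (tperm i j) p * gq).
  rewrite mulrDr mulrA hp mulrCA hq msymM mulrBl mulrBr.
  by rewrite addrA subrK.
have DX l : D 'X_l.
  rewrite /D msymX.
  have -> : [multinom U_(l)%MM ((tperm i j)^-1 m)%g | m < n]
      = U_(tperm i j l)%MM :> 'X_{1..n}.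
    apply/mnmP=> m; rewrite mnmE !mnm1E tpermV.
    by rewrite -(inj_eq (@perm_inj _ (tperm i j))) tpermK.
  case: tpermP => [->|->|_ _].
  - by exists 1; rewrite mulr1.
  - by exists (-1); rewrite mulrN1 opprB.
  - by exists 0; rewrite mulr0 subrr.
rewrite (mpolyE f); apply: (big_ind D) => // m _; apply: DZ.
rewrite mpolyXE_id; apply: (big_ind D) => // l _.
by elim: (m l) => [|e IH]; rewrite ?expr0 // exprS; apply: DM.
Qed.

(* The quotient of f - s f by x_i - x_j, where s exchanges x_i and x_j. *)
Definition divdiff (n : nat) (i j : 'I_n) (f : {mpoly int[n]})
  : {mpoly int[n]} := xchoose (divdiff_subproof i j f).

Lemma divdiffP (n : nat) (i j : 'I_n) (f : {mpoly int[n]}) :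
  ('X_i - 'X_j) * divdiff i j f = f - msym (tperm i j) f.
Proof. exact/eqP/(xchooseP (divdiff_subproof i j f)). Qed.

(* x_1^(n-1) x_2^(n-2) ... x_(n-1), the Schubert polynomial of the longest
   element of 'S_n. *)
Definition staircase (n : nat) : {mpoly int[n]} :=
  \prod_(i < n) 'X_i ^+ (n.-1 - i).

(* S_w = d_i S_(w s_i) at an ascent w(i) < w(i+1).  Each step adds one
   inversion, so binomial n 2 steps are enough to reach the longest element, the
   only permutation without ascents.  The result does not depend on the
   ascents that are picked. *)
Fixpoint schubert_rec (n d : nat) (w : 'S_n) : {mpoly int[n]} :=
  if d is d'.+1 then
    if [pick p : 'I_n * 'I_n | (p.1.+1 == p.2 :> nat) && (w p.1 < w p.2)%N]
      is Some p
    then divdiff p.1 p.2 (schubert_rec d' (permcomp w (tperm p.1 p.2)))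
    else staircase n
  else staircase n.

Definition schubert (n : nat) (w : 'S_n) : {mpoly int[n]} :=
  schubert_rec (binomial n 2) w.

(** * Schur polynomials *)

(* The Young diagram of the partition lam, row c.1 and column c.2. *)
Definition cell (lam : seq nat) : finType :=
  {c : 'I_(size lam) * 'I_(head 0%N lam) | (c.2 < nth 0%N lam c.1)%N}.

(* Semistandard tableaux with entries in the first k letters of [n]. *)
Definition ssyt (n k : nat) (lam : seq nat) (T : {ffun cell lam -> 'I_n})
  : bool :=
  [&& [forall c : cell lam, (T c < k)%N],
      [forall c : cell lam, forall c' : cell lam, ((val c).1 == (val c').1)
         && ((val c).2 < (val c').2)%N ==> (T c <= T c')%N]
    & [forall c : cell lam, forall c' : cell lam, ((val c).2 == (val c').2)
         && ((val c).1 < (val c').1)%N ==> (T c < T c')%N]].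

(* s_lam(x_1, ..., x_k), as an element of Z[x_1, ..., x_n]. *)
Definition schur (n k : nat) (lam : seq nat) : {mpoly int[n]} :=
  \sum_(T : {ffun cell lam -> 'I_n} | ssyt k T) \prod_(c : cell lam) 'X_(T c).

(* The partition (b, 1^(a-1)). *)
Definition hook (a b : nat) : seq nat := b :: nseq a.-1 1%N.

(** * The cohomology ring of the flag manifold *)

(* Equality of the classes of p and q in
   H^* Fl_n = Z[x_1, ..., x_n] / (e_1, ..., e_n). *)
Definition eq_flag (n : nat) (p q : {mpoly int[n]}) : Prop :=
  exists c : 'I_n -> {mpoly int[n]},
    p - q = \sum_(i < n) c i * mesym n int i.+1.

(* Main.v *)
From HB Require Import structures.
Require Import Defs.
From mathcomp Require Import all_boot all_order all_algebra fingroup perm.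
From mathcomp Require Import zify ring.

Set Implicit Arguments.
Unset Strict Implicit.
Unset Printing Implicit Defensive.

Import GRing.Theory.
Local Open Scope ring_scope.

(** Modulo the ideal, multiplication by a variable acts on Schubert polynomials
    through Bruhat covers (Monk's rule, monk_rule), so the theorem is an identity
    between two operators: one obtained from Monk's rule, and one described by
    minimal permutations.  Both are compared by generating functions in t and q.

    Put F_k = prod_(i <= k) (1 + q x_i) / (1 - t x_i).  Then
    F_k = 1 + (t + q) sum_(a, b) s_(b, 1^(a-1))(x_1, ..., x_k) q^(a-1) t^(b-1),
    and removing the largest letter of a hook tableau (hookpolyS) is the
    coefficient form of F_k (1 - t x_k) = (1 + q x_k) F_(k-1).  On the other
    side the binomial coefficients of the theorem say that, for minimal z with
    u <=_k z u, the coefficient of S_(z u) in F_k S_u is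
      prod over nontrivial cycles of z of (t + q) t^(d - 1) q^(h - 1),
    where d and h count the values moved down and up by the cycle; for z other
    than the identity this is (t + q) peakless_weight z.

    The link is peakless_op, a sum over chains in the k-Bruhat order labelled by
    the larger of the two exchanged values, with labels first decreasing and then
    increasing.  It is built up by adding larger and larger labels, and two facts
    are proved along this recursion.

    First, it satisfies the recursion in k of the hook polynomials
    (peakless_op_rec).  Sorted by labels, the Dunkl element that represents x_k
    is the difference of the cover operators for k and k - 1 (dunkl_opS), and the
    Fomin-Kirillov relations give exact commutation rules for each label
    (label_op_dunkl_op, dunkl_op_label_op).

    Second, its matrix entries are the weights above (peakless_opE).  The largest
    label m of a chain belongs to its first or to its last step, and removing
    this step deletes m from its cycle in z.  Deleting m lowers the height by
    at least one plus an excess (height2_delval).  Hence the height is at least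
    the number of moved values minus the number of cycles, and for minimal z the
    excess vanishes, which is what is needed for a step with label m to exist at
    the end or at the beginning of the interval (minimal_pair_split).  This uses
    a formula for the height in terms of z alone (height2, kcrit_height).

    Monk's rule is obtained from the longest permutation, where it says that
    variables annihilate the staircase monomial modulo the ideal (X_staircase),
    by applying divided differences; that these may be applied at any ascent
    rests on the braid relations (schubert_divdiff). *)

(** * Bruhat covers *)

Section PairSplit.
Variables (T : finType) (x y : T).
Hypothesis xy : x != y.

Lemma sum_split2 (F : T -> int) :
  \sum_a F a = \sum_(a | (a != x) && (a != y)) F a + (F x + F y).
Proof.
by rewrite (bigD1 x) //= (bigD1 y) 1?eq_sym //= addrA addrC.
Qed.

(** Exchanging the values at two places changes only the terms of a sum over
    pairs that involve one of these places; after this split such sums are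
    compared term by term. *)
Lemma pair_sum_split2 (G : T -> T -> int) :
  \sum_a \sum_b G a b =
  \sum_(a | (a != x) && (a != y)) \sum_(b | (b != x) && (b != y)) G a b
  + \sum_(a | (a != x) && (a != y)) (G a x + G a y + G x a + G y a)
  + (G x x + G x y + G y x + G y y).
Proof.
rewrite sum_split2 !(sum_split2 (G _)).
under eq_bigr do rewrite sum_split2.
by rewrite !big_split /=; ring.
Qed.
End PairSplit.

Section Covers.
Variable n : nat.
Implicit Types (u v w : 'S_n) (i j x y : 'I_n).

Definition swap u i j : 'S_n := (tperm i j * u)%g.

Lemma swapE u i j x : swap u i j x = u (tperm i j x).
Proof. exact: permM. Qed.

Lemma swapL u i j : swap u i j i = u j. Proof. by rewrite swapE tpermL. Qed.
Lemma swapR u i j : swap u i j j = u i. Proof. by rewrite swapE tpermR. Qed.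
Lemma swapD u i j x : x != i -> x != j -> swap u i j x = u x.
Proof. by move=> xi xj; rewrite swapE tpermD // eq_sym. Qed.

Lemma swapK u i j : swap (swap u i j) i j = u.
Proof. by rewrite /swap mulgA tperm2 mul1g. Qed.

Lemma plengthE u :
  (plength u)%:Z = \sum_(x : 'I_n) \sum_(y : 'I_n) ((x < y)%N && (u y < u x)%N : nat)%:Z.
Proof.
rewrite /plength -sum1_card (eq_bigl (fun p : 'I_n * 'I_n =>
  (p.1 < p.2)%N && (u p.2 < u p.1)%N)); last first.
  by move=> p; rewrite inE.
rewrite pair_big /= big_mkcond /= -[LHS]natz natr_sum.
by apply: eq_bigr => p _; rewrite natz; case: ifP.
Qed.

Definition between u i j x := [&& (i < x)%N, (x < j)%N, (u i < u x)%N & (u x < u j)%N].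

(** A value between u i and u j at a place between i and j forms an inversion
    with both of them after the exchange and with neither of them before. *)
Lemma plength_swap u i j : (i < j)%N -> (u i < u j)%N ->
  (plength (swap u i j))%:Z =
  (plength u)%:Z + 1 + 2%:Z * \sum_x (between u i j x : nat)%:Z.
Proof.
move=> ij uij; have nij : i != j by rewrite -val_eqE /=; lia.
rewrite !plengthE !(pair_sum_split2 nij) (sum_split2 nij).
have -> : (between u i j i : nat)%:Z = 0 by rewrite /between ltnn.
have -> : (between u i j j : nat)%:Z = 0 by rewrite /between ltnn andbF.
rewrite !swapL !swapR.
rewrite (eq_bigr (fun a : 'I_n => \sum_(b | (b != i) && (b != j))
   ((a < b)%N && (u b < u a)%N : nat)%:Z)); last first.
  move=> a /andP[ai aj]; apply: eq_bigr => b /andP[bi bj].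
  by rewrite !swapD.
set S1 := \sum_(_ | _) \sum_(_ | _) _.
rewrite [X in _ + X + _ = _](eq_bigr (fun a : 'I_n =>
  (((a < i)%N && (u i < u a)%N : nat)%:Z + ((a < j)%N && (u j < u a)%N : nat)%:Z
  + ((i < a)%N && (u a < u i)%N : nat)%:Z + ((j < a)%N && (u a < u j)%N : nat)%:Z)
  + 2%:Z * (between u i j a : nat)%:Z)); last first.
  move=> a /andP[ai aj]; rewrite !swapD // /between.
  have uai : u a != u i by rewrite (inj_eq perm_inj).
  have uaj : u a != u j by rewrite (inj_eq perm_inj).
  by move: ai aj uai uaj; rewrite -!val_eqE /=; lia.
rewrite big_split /= -mulr_sumr; set S2 := \sum_(_ | _) _; set S3 := \sum_(_ | _) _.
rewrite !ltnn ij uij (ltnNge j) (ltnW ij) (ltnNge (u j)) (ltnW uij) /=.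
ring.
Qed.

Definition cov u i j :=
  [&& (i < j)%N, (u i < u j)%N & [forall x, ~~ between u i j x]].

Lemma covP u i j : reflect [/\ (i < j)%N, (u i < u j)%N &
    forall x : 'I_n, (i < x)%N -> (x < j)%N -> (u i < u x)%N -> (u x < u j)%N -> False]
  (cov u i j).
Proof.
apply: (iffP and3P) => -[ij uij H]; split=> //.
  by move=> x ix xj uix uxj; move/forallP: H => /(_ x); rewrite /between ix xj uix uxj.
by apply/forallP=> x; apply/negP=> /and4P[]; apply: H.
Qed.

Lemma cov_lt u i j : cov u i j -> (i < j)%N. Proof. by case/and3P. Qed.
Lemma cov_ltu u i j : cov u i j -> (u i < u j)%N. Proof. by case/and3P. Qed.

Lemma plength_cov u i j : cov u i j -> plength (swap u i j) = (plength u).+1.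
Proof.
case/and3P=> ij uij /forallP H; have := plength_swap ij uij.
rewrite big1 => [|x _]; last by rewrite (negPf (H x)).
lia.
Qed.

(** Bruhat covers are handled from here on through the emptiness of a
    rectangle in the graph of u instead of through lengths. *)
Lemma cov_plength u i j : (i < j)%N ->
  (plength (swap u i j) == (plength u).+1) = cov u i j.
Proof.
move=> ij; apply/idP/idP=> [/eqP E|/plength_cov -> //].
have sge0 v : 0 <= \sum_x (between v i j x : nat)%:Z by apply: Num.Theory.sumr_ge0.
have nij : i != j by rewrite -val_eqE /=; lia.
have uij : (u i < u j)%N.
  case: ltngtP => // [uji|/val_inj/perm_inj eij]; last by rewrite eij eqxx in nij.
  have := @plength_swap (swap u i j) i j ij; rewrite swapK swapL swapR => /(_ uji).
  by have := sge0 (swap u i j); lia.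
rewrite /cov ij uij; apply/forallP => x; apply/negP => bx.
have := plength_swap ij uij; rewrite (bigD1 x) //= bx.
set s := (X in true%:Z + X).
have : 0 <= s by apply: Num.Theory.sumr_ge0.
lia.
Qed.

End Covers.

(** * Bruhat operators on functions on the symmetric group *)

Section Operators.
Variables (n : nat) (K : comNzRingType).
Implicit Types (u v w : 'S_n) (i j x y : 'I_n).

(** For disjoint transpositions the rectangles of the two covers are emptied
    independently.  Lengths do not show this: they leave open that the middle
    element of the other order has length plength u - 1 or plength u + 3. *)
Lemma cov_commute u i j x y : i != x -> i != y -> j != x -> j != y ->
  cov u i j -> cov (swap u i j) x y -> cov u x y && cov (swap u x y) i j.
Proof.
move=> ix iy jx jy /covP[ij uij H1] /covP[xy]; rewrite !swapD 1?eq_sym //.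
move=> uxy H2.
have [H1x H1y] := (H1 x, H1 y).
have := H2 i; have := H2 j; rewrite swapL swapR => H2j H2i.
have [d1 d2 d3 d4] : [/\ u i != u x, u i != u y, u j != u x & u j != u y].
  by rewrite !(inj_eq perm_inj).
move: ix iy jx jy d1 d2 d3 d4; rewrite -!val_eqE /= => ix iy jx jy d1 d2 d3 d4.
apply/andP; split; apply/covP; split=> //.
- move=> z; case: (eqVneq z i) => [-> *|zi]; first by lia.
  case: (eqVneq z j) => [-> *|zj]; first by lia.
  by move=> xz zy; have := H2 z xz zy; rewrite swapD.
- by rewrite !swapD -?val_eqE //=; lia.
- move=> z; rewrite ![swap _ _ _ i]swapD ?[swap _ _ _ j]swapD -?val_eqE //=.
  case: (eqVneq z x) => [->|zx]; first by rewrite swapL; lia.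
  case: (eqVneq z y) => [->|zy]; first by rewrite swapR; lia.
  by rewrite swapD //; apply: H1.
Qed.

(** This lemma and the next one say which of the two chains from u to
    swap (swap u x j) i x that avoid swap u x j exists besides the chain
    through swap u x j: exactly one of them does, decided by the order of
    u i and u x. *)
Lemma cov_braid_gt u i x j : (i < x)%N -> (x < j)%N ->
  cov u i j && cov (swap u i j) x j =
  [&& cov u x j, cov (swap u x j) i x & (u x < u i)%N].
Proof.
move=> ix xj; have [nix nxj nij] : [/\ i != x, x != j & i != j].
  by rewrite -!val_eqE /=; split; lia.
have [nxi njx nji] : [/\ x != i, j != x & j != i] by rewrite !(eq_sym j) eq_sym.
have inj y z : y != z -> u y != u z :> nat.
  by move=> yz; rewrite val_eqE (inj_eq perm_inj).
have := inj _ _ nix; have := inj _ _ nxj; have := inj _ _ nij => d1 d2 d3.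
apply/andP/and3P => [[/covP[ij uij H1] /covP[_]]|[/covP[_ uxj H1] /covP[_]]].
  rewrite swapR swapD // => uxi H2; split=> //; apply/covP; split=> //.
  - lia.
  - move=> y xy yj; have := H1 y; have := H2 y xy yj.
    rewrite ?swapL ?swapR ?swapD -?val_eqE /=; try lia.
    by have := inj y i; rewrite -val_eqE /=; lia.
  - by rewrite swapL swapD //; lia.
  - move=> y iy yx; have := H1 y iy.
    rewrite ?swapL ?swapR ?swapD -?val_eqE /=; lia.
rewrite swapL swapD // => uij H2 uxi; split; apply/covP; split=> //.
- lia.
- move=> y iy yj; have := H1 y; have := H2 y iy.
  case: (ltngtP y x) => [yx|xy|/val_inj ->]; last by lia.
    by rewrite ?swapL ?swapR ?swapD -?val_eqE /=; lia.
  by lia.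
- by rewrite swapR swapD 1?eq_sym.
- move=> y xy yj; have := H1 y xy yj.
  rewrite ?swapL ?swapR ?swapD -?val_eqE /=; lia.
Qed.

Lemma cov_braid_lt u i x j : (i < x)%N -> (x < j)%N ->
  cov u i x && cov (swap u i x) i j =
  [&& cov u x j, cov (swap u x j) i x & (u i < u x)%N].
Proof.
move=> ix xj; have [nix nxj nij] : [/\ i != x, x != j & i != j].
  by rewrite -!val_eqE /=; split; lia.
have [nxi njx nji] : [/\ x != i, j != x & j != i] by rewrite !(eq_sym j) eq_sym.
have inj y z : y != z -> u y != u z :> nat.
  by move=> yz; rewrite val_eqE (inj_eq perm_inj).
have := inj _ _ nix; have := inj _ _ nxj; have := inj _ _ nij => d1 d2 d3.
apply/andP/and3P => [[/covP[_ uix H1] /covP[ij]]|[/covP[_ uxj H1] /covP[_]]].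
  rewrite swapL swapD // => uxj H2; split=> //; apply/covP; split=> //.
  - move=> y xy yj; have := H2 y; rewrite ?swapL ?swapR ?swapD -?val_eqE /=; lia.
  - by rewrite swapL swapD //; lia.
  - move=> y iy yx; have := H1 y iy yx; have := H2 y iy.
    rewrite ?swapL ?swapR ?swapD -?val_eqE /=; try lia.
    by have := inj y x; rewrite -val_eqE /=; lia.
rewrite swapL swapD // => uij H2 uix; split; apply/covP; split=> //.
- move=> y iy yx; have := H2 y iy yx; rewrite ?swapL ?swapR ?swapD -?val_eqE /=; lia.
- by lia.
- by rewrite swapL swapD 1?eq_sym.
- move=> y iy yj; rewrite ?swapL [swap _ _ _ j]swapD //.
  case: (ltngtP y x) => [yx|xy|/val_inj ->]; last by rewrite swapR; lia.
    have := H2 y iy yx; rewrite ?swapL ?swapR ?swapD -?val_eqE /=; lia.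
  by have := H1 y; rewrite swapD -?val_eqE /=; lia.
Qed.

Notation V := {ffun 'S_n -> K^o}.

(** The operators act on functions, contravariantly: in
    cover_op i j (cover_op x y f) the cover along (i, j) is climbed first. *)
Definition cover_op i j (f : V) : V :=
  [ffun u : 'S_n => if cov u i j then f (swap u i j) else 0].

Fact cover_op_is_linear i j : linear (cover_op i j).
Proof.
move=> c f g; apply/ffunP=> u; rewrite !ffunE; case: ifP => // _.
by rewrite scaler0 addr0.
Qed.
HB.instance Definition _ i j :=
  GRing.isLinear.Build K V V _ (cover_op i j) (cover_op_is_linear i j).

(** The k-Bruhat covers whose label, the larger one of the two exchanged
    values, is m. *)
Definition label_op (k m : nat) (f : V) : V :=
  \sum_(j : 'I_n) \sum_(i : 'I_n | (i < k)%N && (k <= j)%N)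
    [ffun u : 'S_n => if u j == m :> nat then cover_op i j f u else 0].

Lemma label_opE k m f u : label_op k m f u =
  \sum_(j : 'I_n | (u j == m :> nat) && (k <= j)%N) \sum_(i : 'I_n | (i < k)%N) cover_op
    i j f u.
Proof.
rewrite /label_op sum_ffunE [RHS]big_mkcond /=; apply: eq_bigr => j _.
rewrite sum_ffunE; case: (leqP k j) => kj; last first.
  by rewrite andbF big_pred0 // => i; rewrite andbF.
rewrite andbT; case: ifP => um.
  by apply: eq_big => [i|i _]; rewrite ?andbT // ffunE um.
by rewrite big1 // => i _; rewrite ffunE um.
Qed.

Fact label_op_is_linear k m : linear (label_op k m).
Proof.
move=> c f g; apply/ffunP=> u; rewrite !ffunE !label_opE.
rewrite scaler_sumr -big_split; apply: eq_bigr => j _.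
rewrite scaler_sumr -big_split; apply: eq_bigr => i _.
by rewrite linearP !ffunE.
Qed.
HB.instance Definition _ k m :=
  GRing.isLinear.Build K V V _ (label_op k m) (label_op_is_linear k m).

(** The Dunkl element of position x, restricted to covers with label less than
    m.  With m = n it becomes, modulo the ideal, multiplication by the
    variable of index x when applied to Schubert polynomials. *)
Definition dunkl_op x (m : nat) (f : V) : V :=
  [ffun u : 'S_n => \sum_l if (maxn (u x) (u l) < m)%N then cover_op x l f u -
    cover_op l x f u else 0].

Fact dunkl_op_is_linear x m : linear (dunkl_op x m).
Proof.
move=> c f g; apply/ffunP=> u; rewrite !ffunE.
rewrite scaler_sumr -big_split; apply: eq_bigr => l _ /=.
case: ifP => _; last by rewrite scaler0 addr0.
rewrite !linearP !ffunE scalerBr opprD addrACA //.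
Qed.
HB.instance Definition _ x m :=
  GRing.isLinear.Build K V V _ (dunkl_op x m) (dunkl_op_is_linear x m).

Lemma cover_op_ge i j f u : (j <= i)%N -> cover_op i j f u = 0.
Proof. by move=> ji; rewrite ffunE /cov ltnNge ji. Qed.

Lemma cover_op_gev i j f u : (u j <= u i)%N -> cover_op i j f u = 0.
Proof. by move=> ji; rewrite ffunE /cov [(u i < u j)%N]ltnNge ji andbF. Qed.

Lemma label_op_at k (j : 'I_n) f u : (k <= j)%N ->
  label_op k (u j) f u = \sum_(i : 'I_n | (i < k)%N) cover_op i j f u.
Proof.
move=> kj; rewrite label_opE (big_pred1 j) // => j' /=.
by rewrite val_eqE (inj_eq perm_inj); case: eqVneq => // ->; rewrite kj.
Qed.

Lemma label_op_off k (j : 'I_n) f u : (j < k)%N -> label_op k (u j) f u = 0.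
Proof.
move=> jk; rewrite label_opE big_pred0 // => j' /=.
by rewrite val_eqE (inj_eq perm_inj); case: eqVneq => // ->; rewrite leqNgt jk.
Qed.

Lemma dunkl_op0 x f : dunkl_op x 0 f = 0.
Proof. by apply/ffunP=> u; rewrite !ffunE big1 // => l _. Qed.

(** Sorted by labels, the Dunkl element of position x is the difference of the
    cover operators of the orders for x.+1 and x: a cover exchanging x with a
    larger position belongs to the first order only, one exchanging x with a
    smaller position to the second only. *)
Lemma dunkl_opS x m f : dunkl_op x m.+1 f = dunkl_op x m f + label_op x.+1 m f - label_op x m f.
Proof.
apply/ffunP=> u; rewrite !ffunE !label_opE -addrA; apply/eqP.
rewrite -subr_eq0 opprD addrA -sumrB subr_eq0; apply/eqP.
pose G j i := if u j == m :> nat then cover_op i j f u else 0.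
transitivity (\sum_l (G l x - G x l)).
  apply: eq_bigr => l _; rewrite /G.
  rewrite !ltnS; case: (ltngtP (u x) (u l)) => xl.
  - rewrite (cover_op_gev _ (ltnW xl)); case: (ltngtP (u l) m) => um;
    by rewrite ?if_same ?subr0 ?sub0r ?subrr ?oppr0.
  - rewrite (cover_op_gev _ (ltnW xl)); case: (ltngtP (u x) m) => um;
    by rewrite ?if_same ?subr0 ?sub0r ?subrr ?oppr0.
  - have -> : cover_op x l f u = 0 by apply: cover_op_gev; rewrite xl.
    have -> : cover_op l x f u = 0 by apply: cover_op_gev; rewrite xl.
    by rewrite !subrr !if_same subrr.
have E k : \sum_(j : 'I_n | (u j == m :> nat) && (k <= j)%N) \sum_(i : 'I_n | (i < k)%N)
  cover_op i j f u
   = \sum_(j : 'I_n) \sum_(i : 'I_n) if (i < k <= j)%N then G j i else 0.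
  rewrite big_mkcond; apply: eq_bigr => j _; rewrite /G.
  case: eqP => um /=; last by rewrite big1 // => i _; rewrite if_same.
  case: (leqP k j) => kj; last by rewrite big1 // => i _; rewrite andbF.
  by rewrite big_mkcond; apply: eq_bigr => i _; rewrite andbT.
rewrite !E -sumrB.
transitivity (\sum_j \sum_i ((if i == x then G j x else 0) - (if j == x then G x i else 0))).
  under [RHS]eq_bigr do rewrite sumrB.
  rewrite sumrB [RHS]sumrB; congr (_ - _).
    by apply: eq_bigr => j _; rewrite -big_mkcond big_pred1_eq.
  rewrite exchange_big /=; apply: eq_bigr => i _.
  by rewrite -big_mkcond big_pred1_eq.
apply: eq_bigr => j _; rewrite -sumrB; apply: eq_bigr => i _.
have G0 (a c : 'I_n) : (a <= c)%N -> G a c = 0 by move=> ac; rewrite /G cover_op_ge // if_same.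
have -> : (i == x) = (i == x :> nat) by [].
have -> : (j == x) = (j == x :> nat) by [].
rewrite !ltnS; case: (ltngtP i x) => [ix|xi|/val_inj ->];
  case: (ltngtP x j) => [xj|jx|/val_inj <-];
  rewrite ?(ltnS i) ?leqnn ?ltnn /=; repeat case: ifP => ?;
  rewrite ?subrr ?subr0 ?sub0r //; rewrite ?G0 ?subrr ?oppr0 //; lia.
Qed.

End Operators.

(** * Relations between labelled operators, and the peakless operator *)

Section Relations.
Variables (n : nat) (K : comNzRingType).
Implicit Types (u v w : 'S_n) (i j x y : 'I_n).
Notation V := {ffun 'S_n -> K^o}.
Implicit Types f : V.

Lemma cover_op_comp i j x y f u : cover_op i j (cover_op x y f) u =
  if cov u i j && cov (swap u i j) x y then f (swap (swap u i j) x y) else 0.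
Proof. by rewrite !ffunE; case: ifP. Qed.

Lemma swap_commute u i j x y : i != x -> i != y -> j != x -> j != y ->
  swap (swap u i j) x y = swap (swap u x y) i j.
Proof.
move=> ix iy jx jy; apply/permP => z.
have [xi yi xj yj] : [/\ x != i, y != i, x != j & y != j].
  by rewrite ![_ == i]eq_sym ![_ == j]eq_sym.
case: (eqVneq z i) => [->|zi]; first by rewrite swapL [LHS]swapD // [RHS]swapD // swapL.
case: (eqVneq z j) => [->|zj]; first by rewrite swapR [LHS]swapD // [RHS]swapD // swapR.
case: (eqVneq z x) => [->|zx]; first by rewrite swapL [LHS]swapD // [RHS]swapD // swapL.
case: (eqVneq z y) => [->|zy]; first by rewrite swapR [LHS]swapD // [RHS]swapD // swapR.
by rewrite !swapD.
Qed.

Lemma cover_op_commute i j x y f u : i != x -> i != y -> j != x -> j != y ->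
  cover_op i j (cover_op x y f) u = cover_op x y (cover_op i j f) u.
Proof.
move=> ix iy jx jy; rewrite !cover_op_comp swap_commute //.
congr (if _ then _ else _); apply/andP/andP => -[H1 H2]; apply/andP.
  exact: cov_commute.
by apply: cov_commute; rewrite // eq_sym.
Qed.

(** The three-term relation of the Fomin-Kirillov algebra. *)
Lemma cover_op_braid i x j f u : (i < x)%N -> (x < j)%N ->
  cover_op i j (cover_op x j f) u + cover_op i x (cover_op i j f) u =
    cover_op x j (cover_op i x f) u.
Proof.
move=> ix xj; have [nix nxj nij] : [/\ i != x, x != j & i != j].
  by rewrite -!val_eqE /=; split; lia.
have [nxi njx nji] : [/\ x != i, j != x & j != i] by rewrite !(eq_sym j) eq_sym.
have E1 : swap (swap u i j) x j = swap (swap u x j) i x.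
  apply/permP => z.
  case: (eqVneq z x) => [->|zx]; first by rewrite swapL swapR swapR swapD.
  case: (eqVneq z j) => [->|zj].
    by rewrite swapR swapD // [RHS]swapD // swapR.
  case: (eqVneq z i) => [->|zi]; first by rewrite swapD // !swapL.
  by rewrite !swapD.
have E2 : swap (swap u i x) i j = swap (swap u x j) i x.
  apply/permP => z.
  case: (eqVneq z x) => [->|zx].
    by rewrite swapD // !swapR swapD.
  case: (eqVneq z j) => [->|zj].
    by rewrite swapR swapL [RHS]swapD // swapR.
  case: (eqVneq z i) => [->|zi]; first by rewrite !swapL swapD.
  by rewrite !swapD.
rewrite !cover_op_comp E1 E2 cov_braid_gt // cov_braid_lt //.
have : u i != u x :> nat by rewrite val_eqE (inj_eq perm_inj).
case: (cov u x j) => //=; last by rewrite addr0.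
case: (cov _ i x) => //=; last by rewrite addr0.
by case: ltngtP => //= _ _; rewrite ?addr0 ?add0r.
Qed.

(** After one cover with label m the value m is at a position less than k,
    where it is never again the larger value of a k-Bruhat cover at a position
    at least k. *)
Lemma label_op_label_op k m f : label_op k m (label_op k m f) = 0.
Proof.
apply/ffunP=> u; rewrite label_opE ffunE big1 // => j /andP[/eqP um kj].
rewrite big1 // => i ik; rewrite ffunE; case: ifP => // _.
by rewrite -um -[u j in LHS](swapL u i j) label_op_off.
Qed.

(** The relation on which Pieri-type formulas rest.  Take u j = m.  If
    j <= x, both sides vanish for positional reasons.  If x < j, a cover
    along (i, j) and a term of the Dunkl element on a position other than
    i and j commute, and the positions i and j together give the three-term
    relation. *)
Lemma label_op_dunkl_op x (m : 'I_n) f :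
  label_op x.+1 m (dunkl_op x m f) = dunkl_op x m.+1 (label_op x m f).
Proof.
apply/ffunP=> u; pose j := (u^-1)%g m; have uj : u j = m by rewrite permKV.
have um l : l != j -> u l != m :> nat.
  by move=> lj; rewrite -uj val_eqE (inj_eq perm_inj).
have bopv v (p : 'I_n) : v p = m -> (x <= p)%N ->
    label_op x m f v = \sum_(i : 'I_n | (i < x)%N) cover_op i p f v.
  by move=> <-; apply: label_op_at.
clearbody j; rewrite [RHS]ffunE; case: (ltnP x j) => xj; last first.
  rewrite -{1}uj label_op_off // big1 // => l _; case: ifP => // lab.
  have T0 p r : ((p == x) && (r == l)) || ((p == l) && (r == x)) ->
      cover_op p r (label_op x m f) u = 0.
    move=> pr; rewrite ffunE; case: ifP => // /covP[plr upr _].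
    case: (eqVneq p j) => [pj|pj].
      have : (u r <= maxn (u x) (u l))%N.
        by case/orP: pr => /andP[_ /eqP->]; rewrite leq_max leqnn ?orbT.
      by move: upr lab; rewrite pj uj; lia.
    case: (eqVneq r j) => [rj|rj]; last first.
      rewrite -uj -(@swapD _ u p r j) 1?eq_sym // label_op_off //.
      rewrite ltn_neqAle xj andbT val_eqE; apply: contraTneq pr => <-.
      by rewrite (negPf pj) (negPf rj) andbF.
    by rewrite -uj -rj -(swapL u p r) label_op_off //; move: plr; rewrite rj; lia.
  by rewrite !T0 ?eqxx ?orbT // subrr.
(* The cover along (x, j) puts m at x, where all labels are at least m. *)
rewrite -{1}uj label_op_at // (bigD1 x) //= {1}ffunE.
have -> : (if cov u x j then dunkl_op x m f (swap u x j) else 0) = 0.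
  case: ifP => // _; rewrite ffunE big1 // => l _.
  by rewrite swapL uj; case: ifP => //; lia.
rewrite add0r (eq_bigl (fun i : 'I_n => (i < x)%N)); last first.
  by move=> i; rewrite -val_eqE /=; lia.
have jx : j != x by rewrite -val_eqE /=; lia.
pose R i l := if l == j then cover_op x j (cover_op i x f) u else
  if (maxn (u x) (u l) < m.+1)%N then cover_op x l (cover_op i j f) u -
    cover_op l x (cover_op i j f) u else 0.
(* After the exchange of x and j the value m is at x, hence the case l = j. *)
transitivity (\sum_l \sum_(i : 'I_n | (i < x)%N) R i l); last first.
  apply: eq_bigr => l _; rewrite /R; case: (eqVneq l j) => [->|lj].
    rewrite [cover_op j x _ u](cover_op_ge _ _ (ltnW xj)) subr0 uj [X in if _ then X else
      _]ffunE.
    rewrite (bopv (swap u x j) x) // ?swapL ?uj //.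
    transitivity (if cov u x j then \sum_(i : 'I_n | (i < x)%N) cover_op i x f (swap u x
      j) else 0).
      case: ifP => cv; last by rewrite big1 // => i _; rewrite ffunE cv.
      by apply: eq_bigr => i _; rewrite ffunE cv.
    case: ifP => cv; last by rewrite if_same.
    by have := cov_ltu cv; rewrite uj => uxm; rewrite gtn_max leqnn ltnS ltnW.
  case: ifP => lab; last by rewrite big1.
  rewrite sumrB; congr (_ - _).
    rewrite [RHS]ffunE (bopv (swap u x l) j) ?(ltnW xj) ?swapD 1?(eq_sym j l) ?uj //.
    by case: ifP => cv; [apply: eq_bigr|rewrite big1] => // i _; rewrite ffunE cv.
  rewrite [RHS]ffunE (bopv (swap u l x) j) ?(ltnW xj) ?swapD 1?(eq_sym j l) ?uj //.
  by case: ifP => cv; [apply: eq_bigr|rewrite big1] => // i _; rewrite ffunE cv.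
rewrite exchange_big /=; apply: eq_bigr => i ix.
have [nix nij] : i != x /\ i != j by rewrite -!val_eqE /=; lia.
pose Q l := if cov u i j then
   if (maxn (swap u i j x) (swap u i j l) < m)%N
   then cover_op x l f (swap u i j) - cover_op l x f (swap u i j) else 0 else 0.
transitivity (\sum_l Q l).
  by rewrite ffunE /Q; case: ifP => cv; rewrite ?ffunE // big1.
rewrite (bigD1 j) //= (bigD1 i) //= [RHS](bigD1 j) //= [in RHS](bigD1 i) //=.
rewrite !addrA; congr (_ + _); last first.
  apply: eq_bigr => l /andP[lj li]; rewrite /Q /R (negPf lj).
  case: (eqVneq l x) => [->|lx]; first by rewrite !cover_op_ge // !subrr !if_same.
  rewrite (@cover_op_commute x l i j) 1?(@cover_op_commute l x i j) // 1?eq_sym //.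
  rewrite ![cover_op i j _ u]ffunE !swapD // 1?eq_sym // .
  have := um l lj; have := um x; rewrite eq_sym jx => /(_ isT) ux ul.
  have -> : (maxn (u x) (u l) < m.+1)%N = (maxn (u x) (u l) < m)%N by lia.
  by case: ifP => // _; rewrite subrr if_same.
rewrite {2}/Q swapL uj.
have -> : (maxn (swap u i j x) m < m)%N = false by lia.
rewrite if_same addr0 /Q /R eqxx (negPf nij) [cover_op j x _ _](cover_op_ge _ _ (ltnW
  xj)) subr0.
rewrite [cover_op x i _ u](cover_op_ge _ _ (ltnW ix)) sub0r swapR swapD // 1?eq_sym //.
rewrite -(cover_op_braid _ _ ix xj) -[LHS]addr0 -addrA; congr (_ + _).
  rewrite [RHS]ffunE; case: ifP => // /cov_ltu; rewrite uj => uim.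
  case: ifP => // lab; rewrite cover_op_gev // swapR swapD // 1?eq_sym //.
  by move: lab; rewrite gtn_max uim andbT; lia.
case: ifP => [_|lab]; first by rewrite subrr.
rewrite cover_op_comp; case: ifP => //; last by rewrite addr0.
move=> /andP[/cov_ltu u1 /cov_ltu]; rewrite swapL swapD 1?(eq_sym j i) // uj => u2.
by move: lab; rewrite gtn_max; lia.
Qed.

(** Follows from the preceding relation because label_op squares to 0. *)
Lemma dunkl_op_label_op x (m : 'I_n) f :
  label_op x.+1 m (dunkl_op x m.+1 f) = dunkl_op x m (label_op x m f).
Proof.
by rewrite dunkl_opS linearB linearD /= label_op_dunkl_op label_op_label_op addr0
  dunkl_opS label_op_label_op subr0 addrK.
Qed.

Variables t q : K.

(** Weighted sum over nonempty chains whose labels, all less than m, first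
    decrease and then increase.  A step whose label m exceeds all the others is
    the first one (factor q), the last one (factor t) or the whole chain.
    With v_l for label_op k l, the operator 1 + (t + q) peakless_op is
    (1 + q v_(m-1)) ... (1 + q v_0) (1 + t v_0) ... (1 + t v_(m-1)), where
    the two factors at 0 merge into 1 + (t + q) v_0. *)
Fixpoint peakless_op (k m : nat) f : V :=
  if m is m'.+1 then
    let g := peakless_op k m' (f + t *: label_op k m' f) in g + q *: label_op k m' g +
      label_op k m' f
  else 0.

Let scaleK (c d : K) : c *: (d : K^o) = c * d. Proof. by []. Qed.

Fact peakless_op_is_linear k m : linear (peakless_op k m).
Proof.
elim: m => [|m IH] c f g; first by rewrite /peakless_op scaler0 addr0.
rewrite /= -/(peakless_op k m _).
have -> : c *: f + g + t *: label_op k m (c *: f + g) =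
   c *: (f + t *: label_op k m f) + (g + t *: label_op k m g).
  rewrite linearP; apply/ffunP=> u; rewrite !ffunE !scaleK; ring.
rewrite IH !linearP; move: (peakless_op _ _ _) (peakless_op _ _ _) => A B.
apply/ffunP=> u; rewrite !ffunE !scaleK; ring.
Qed.
HB.instance Definition _ k m :=
  GRing.isLinear.Build K V V _ (peakless_op k m) (peakless_op_is_linear k m).

Let label_opD k m : {morph @label_op n K k m : f g / f + g} := linearD _.
Let dunkl_opD x m : {morph @dunkl_op n K x m : f g / f + g} := linearD _.

(** If P is peakless_op x and P' is peakless_op x.+1, this is
    P' (1 - t D) = (1 + q D) P + D for the Dunkl element D of position x, the
    counterpart of the passage from x to x + 1 variables in the generating
    function of hook Schur polynomials.  Both sides change in the same way
    when a larger label is added, by the two commutation relations. *)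
Lemma peakless_op_rec (x : 'I_n) m f : (m <= n)%N ->
  peakless_op x.+1 m (f - t *: dunkl_op x m f) =
  peakless_op x m f + q *: dunkl_op x m (peakless_op x m f) + dunkl_op x m f.
Proof.
elim: m f => [|m IH] f mn.
  by rewrite /= !dunkl_op0 scaler0 !addr0.
have {IH}IHm := IH _ (ltnW mn).
have bt : forall g : V, label_op x.+1 m (dunkl_op x m g) = dunkl_op x m.+1 (label_op x m g).
  exact (@label_op_dunkl_op x (Ordinal mn)).
have tb : forall g : V, label_op x.+1 m (dunkl_op x m.+1 g) = dunkl_op x m (label_op x m g).
  exact: (@dunkl_op_label_op x (Ordinal mn)).
rewrite [LHS]/=.
have b1 : label_op x.+1 m (f - t *: dunkl_op x m.+1 f) =
    label_op x.+1 m f - t *: dunkl_op x m (label_op x m f) by rewrite linearB linearZ /= tb.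
pose F := f + t *: label_op x m f.
have -> : f - t *: dunkl_op x m.+1 f + t *: label_op x.+1 m (f - t *: dunkl_op x m.+1 f) =
    F - t *: dunkl_op x m F.
  have -> : dunkl_op x m F = dunkl_op x m f + t *: dunkl_op x m (label_op x m f).
    by rewrite linearD linearZ.
  rewrite b1 dunkl_opS /F.
  move: (label_op x.+1 m f) (label_op x m f) (dunkl_op x m f) => bf af tf.
  move: (dunkl_op x m af) => taf.
  apply/ffunP=> u; rewrite !ffunE !scaleK; ring.
rewrite IHm b1.
have -> : peakless_op x m.+1 f =
  peakless_op x m F + q *: label_op x m (peakless_op x m F) + label_op x m f by [].
move: (peakless_op x m F) => G.
have aF : label_op x m F = label_op x m f.
  by rewrite linearD linearZ /= label_op_label_op scaler0 addr0.
have -> : label_op x.+1 m (G + q *: dunkl_op x m G + dunkl_op x m F) = label_op x.+1 m G +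
    q *: dunkl_op x m.+1 (label_op x m G) + dunkl_op x m.+1 (label_op x m f).
  by rewrite !label_opD linearZ /= !bt aF.
have -> : dunkl_op x m.+1 (G + q *: label_op x m G + label_op x m f) = dunkl_op x m.+1 G +
    q *: dunkl_op x m.+1 (label_op x m G) + dunkl_op x m.+1 (label_op x m f).
  by rewrite !dunkl_opD linearZ.
have -> : dunkl_op x m F = dunkl_op x m f + t *: dunkl_op x m (label_op x m f).
  by rewrite linearD linearZ.
rewrite !(dunkl_opS x m G) !(dunkl_opS x m f).
move: (label_op x.+1 m f) (label_op x m f) (dunkl_op x m f) => bf af tf.
move: (dunkl_op x m.+1 af) (dunkl_op x m af) (dunkl_op x m.+1 (label_op x m G)) =>
  t'af taf t'aG.
move: (label_op x.+1 m G) (label_op x m G) (dunkl_op x m G) => bG aG tG.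
apply/ffunP=> u; rewrite !ffunE !scaleK; ring.
Qed.
End Relations.

(** * The k-Bruhat order by inequalities, and the height of a permutation *)

Section Criterion.
Variable n : nat.
Implicit Types (u v w z : 'S_n) (i j x y m g : 'I_n).

(** In contrast to the existence of a chain these inequalities can be read off
    from u and w; they are necessary for u <=_k w (kbruhat_kcrit), and for
    minimal w u^-1 also sufficient (minimal_pair_kbruhat). *)
Definition kcrit (k : nat) u w :=
  [forall x : 'I_n, if (x < k)%N then (u x <= w x)%N else (w x <= u x)%N] &&
  [forall x : 'I_n, forall y : 'I_n,
    [&& (x < y)%N, (y < k)%N || (k <= x)%N & (u x < u y)%N] ==> (w x < w y)%N].

Lemma kcritP k u w : reflect [/\ forall x : 'I_n, (x < k)%N -> (u x <= w x)%N,
    forall x : 'I_n, (k <= x)%N -> (w x <= u x)%N &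
    forall x y : 'I_n, (x < y)%N -> (y < k)%N || (k <= x)%N ->
      (u x < u y)%N -> (w x < w y)%N]
  (kcrit k u w).
Proof.
apply: (iffP andP) => [[/forallP H1 /forallP H2]|[H1 H2 H3]]; split.
- by move=> x xk; have := H1 x; rewrite xk.
- by move=> x xk; have := H1 x; rewrite ltnNge xk.
- by move=> x y xy s uxy; have /forallP /(_ y) := H2 x; rewrite xy s uxy.
- apply/forallP => x; case: ltnP; [exact: H1|exact: H2].
- by apply/forallP => x; apply/forallP => y; apply/implyP => /and3P[]; apply: H3.
Qed.

Lemma kcrit_refl k u : kcrit k u u.
Proof. by apply/kcritP; split. Qed.

Lemma kcrit_trans k v u w : kcrit k u v -> kcrit k v w -> kcrit k u w.
Proof.
move=> /kcritP[a1 a2 a3] /kcritP[b1 b2 b3]; apply/kcritP; split.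
- by move=> x xk; apply: leq_trans (a1 x xk) (b1 x xk).
- by move=> x xk; apply: leq_trans (b2 x xk) (a2 x xk).
- by move=> x y xy s uxy; apply: b3 => //; apply: a3.
Qed.

Lemma perm_neq u x y : x != y -> u x != u y :> nat.
Proof. by move=> xy; rewrite val_eqE (inj_eq perm_inj). Qed.

Lemma cov_kcrit k u i j : (i < k)%N -> (k <= j)%N -> cov u i j -> kcrit k u (swap u i j).
Proof.
move=> ik kj /covP[ij uij H].
have sE x : swap u i j x = if x == i then u j else if x == j then u i else u x.
  by rewrite swapE; case: tpermP => [->|->|/eqP/negPf-> /eqP/negPf->] //;
    rewrite eqxx //; case: eqP => // ->.
apply/kcritP; split=> [x xk|x kx|x y xy s uxy]; rewrite !sE.
- case: eqP => [->|_]; first by lia.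
  by case: eqP => // xj; move: xk; rewrite xj; lia.
- case: eqP => [xi|_]; first by move: kx; rewrite xi; lia.
  by case: eqP => // ->; lia.
- have Hx := H x; have Hy := H y.
  have dxj : x != j -> u x != u j :> nat by apply: perm_neq.
  have dyj : y != j -> u y != u j :> nat by apply: perm_neq.
  have dxi : x != i -> u x != u i :> nat by apply: perm_neq.
  have dyi : y != i -> u y != u i :> nat by apply: perm_neq.
  move: dxj dyj dxi dyi xy s uxy Hx Hy; rewrite -!val_eqE /=.
  case: (eqVneq (x : nat) i) => [/val_inj ?|?]; case: (eqVneq (y : nat) i) => [/val_inj ?|?];
  case: (eqVneq (x : nat) j) => [/val_inj ?|?]; case: (eqVneq (y : nat) j) => [/val_inj ?|?];
  subst; lia.
Qed.

Lemma kbruhat_kcrit k u w : kbruhat k u w -> kcrit k u w.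
Proof.
case/connectP => p; elim: p u => [|v p IH] u /=; first by move=> _ ->; apply: kcrit_refl.
case/andP=> /existsP[i /existsP[j /and4P[ik kj /eqP vE lv]]] vp wE.
apply: (kcrit_trans _ (IH _ vp wE)); move: lv; rewrite vE => lv.
apply: cov_kcrit => //; rewrite -cov_plength //; exact: leq_trans ik kj.
Qed.

Lemma cov_kbruhat k u i j : (i < k)%N -> (k <= j)%N -> cov u i j -> kbruhat k u (swap u i j).
Proof.
move=> ik kj cv; apply: connect1; apply/existsP; exists i; apply/existsP; exists j.
by rewrite ik kj eqxx /= (plength_cov cv).
Qed.

Definition chi z x : int := ((x < z x)%N : nat)%:Z - ((z x < x)%N : nat)%:Z.
Definition flip z x y : bool := (x < y)%N != (z x < z y)%N.
(** Twice the height of z; the sum over ordered pairs counts every pair whose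
    order is reversed by z two times.  It is defined from z alone, so that the
    height is independent of the choice of u and k as soon as kcrit_height
    is known. *)
Definition height2 z : int :=
  - \sum_x \sum_y chi z x * chi z y * (flip z x y : nat)%:Z.

Lemma flip_sym z x y : flip z x y = flip z y x.
Proof.
case: (eqVneq x y) => [->//|xy]; have := perm_neq z xy; move: xy.
by rewrite /flip -val_eqE /=; lia.
Qed.

Lemma flipxx z x : flip z x x = false.
Proof. by rewrite /flip !ltnn. Qed.

(** Signs at fixed points do not matter: as many moved values cross a fixed
    value upwards as downwards. *)
Lemma height2_sign z (s : 'I_n -> int) :
  (forall x, z x != x -> s x = chi z x) ->
  \sum_x \sum_y s x * s y * (flip z x y : nat)%:Z =
  \sum_x \sum_y chi z x * chi z y * (flip z x y : nat)%:Z.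
Proof.
move=> sE; pose e x := s x - chi z x.
have eE x : z x != x -> e x = 0 by move=> zx; rewrite /e sE // subrr.
(* Values crossing y upwards minus values crossing y downwards. *)
have cross y : z y = y -> \sum_x chi z x * (flip z x y : nat)%:Z = 0.
  move=> zy.
  transitivity (\sum_(x : 'I_n) (((x < y)%N : nat)%:Z - ((z x < y)%N : nat)%:Z)).
    by apply: eq_bigr => x _; rewrite /chi /flip zy; lia.
  rewrite sumrB [X in X - _](reindex_inj (@perm_inj _ z)) /=.
  by rewrite subrr.
have ec x : \sum_y e x * chi z y * (flip z x y : nat)%:Z = 0.
  case: (eqVneq (z x) x) => [zx|zx]; last first.
    by rewrite big1 // => y _; rewrite eE // !mul0r.
  under eq_bigr do rewrite flip_sym -mulrA.
  by rewrite -mulr_sumr cross // mulr0.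
have ee x y : e x * e y * (flip z x y : nat)%:Z = 0.
  case: (eqVneq (z x) x) => [zx|zx]; last by rewrite eE // !mul0r.
  case: (eqVneq (z y) y) => [zy|zy]; last by rewrite (eE y) // mulr0 mul0r.
  by rewrite /flip zx zy eqxx mulr0.
transitivity (\sum_x \sum_y chi z x * chi z y * (flip z x y : nat)%:Z
  + (\sum_x \sum_y e x * chi z y * (flip z x y : nat)%:Z
   + \sum_x \sum_y e y * chi z x * (flip z y x : nat)%:Z)).
  rewrite -!big_split; apply: eq_bigr => x _ /=.
  rewrite -!big_split; apply: eq_bigr => y _ /=.
  have := ee x y; rewrite (flip_sym _ y x) /e; move: (flip z x y : nat)%:Z => F H.
  by rewrite -[LHS]subr0 -H; ring.
rewrite [X in _ + (X + _)]big1; last by move=> x _; apply: ec.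
rewrite [X in _ + (_ + X)]exchange_big [X in _ + (_ + X)]big1 /=; last first.
  by move=> x _; apply: ec.
by rewrite !addr0.
Qed.

(** Let s be 1 on values at positions less than k and -1 on the others.  By the
    inequalities of kcrit a pair of values reversed by w u^-1 contributes -1 to
    the difference of lengths if both values have the same sign, and 1 if
    not. *)
Lemma kcrit_height k u w : kcrit k u w ->
  2%:Z * ((plength w)%:Z - (plength u)%:Z) = height2 (u^-1 * w)%g.
Proof.
move=> /kcritP[H1 H2 H3]; set z := (u^-1 * w)%g.
have zu x : z (u x) = w x by rewrite /z permM permK.
pose s x : int := if ((u^-1)%g x < k)%N then 1 else -1.
rewrite /height2 -(@height2_sign z s); last first.
  move=> x; rewrite -(permKV u x); set y := (u^-1)%g x.
  rewrite zu /s /chi permK zu => wux; have : w y != u y :> nat by [].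
  by case: ltnP => yk; [have := H1 _ yk|have := H2 _ yk]; lia.
rewrite [in RHS](reindex_inj (@perm_inj _ u)) /=.
under [in RHS]eq_bigr do rewrite (reindex_inj (@perm_inj _ u)) /=.
have sym (G : 'I_n -> 'I_n -> int) : (forall x y, G x y = G y x) -> (forall x, G x x = 0) ->
    \sum_x \sum_y G x y = 2%:Z * \sum_(x : 'I_n) \sum_(y : 'I_n) if (x < y)%N then G x y else 0.
  move=> Gs G0.
  transitivity (\sum_(x : 'I_n) \sum_(y : 'I_n) (if (x < y)%N then G x y else 0)
    + \sum_(x : 'I_n) \sum_(y : 'I_n) (if (x < y)%N then G x y else 0)); last by ring.
  rewrite [X in _ = _ + X]exchange_big -big_split; apply: eq_bigr => x _ /=.
  rewrite -big_split; apply: eq_bigr => y _ /=; rewrite (Gs y x).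
  by case: ltngtP => [_|_|/val_inj ->]; rewrite ?addr0 ?add0r // G0.
rewrite sym; first last.
- by move=> x; rewrite flipxx mulr0.
- by move=> x y; rewrite flip_sym [_ * s (u y)]mulrC.
rewrite -mulrN; congr (_ * _); rewrite !plengthE -sumrB -sumrN.
apply: eq_bigr => x _; rewrite -sumrB -sumrN; apply: eq_bigr => y _.
rewrite /flip !zu /s !permK; case: (ltnP x y) => xy; last by rewrite subrr oppr0.
have nxy : x != y by rewrite -val_eqE /=; lia.
have := perm_neq u nxy; have := perm_neq w nxy => dw du.
have h3 := H3 _ _ xy.
case: (ltnP x k) => xk; case: (ltnP y k) => yk.
- by move: h3; rewrite yk /= => /(_ isT); rewrite !mul1r; lia.
- by have := H1 _ xk; have := H2 _ yk; rewrite !mul1r mulN1r; lia.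
- by lia.
- by move: h3; rewrite xk orbT => /(_ isT); rewrite mulrNN !mul1r; lia.
Qed.

End Criterion.

(** * Removing the largest moved value from its cycle *)

Section Removal.
Variable n : nat.
Implicit Types (u v w z : 'S_n) (i j x y m g : 'I_n).

Definition fixes_from (m : nat) z := [forall x : 'I_n, (m <= x)%N ==> (z x == x)].

Lemma fixes_fromP (m : nat) z : reflect (forall x : 'I_n, (m <= x)%N ->
  z x = x) (fixes_from m z).
Proof.
apply: (iffP forallP) => H x.
  by move=> mx; apply/eqP; have := H x; rewrite mx.
by apply/implyP => mx; apply/eqP/H.
Qed.

Lemma fixes_from0 z : fixes_from 0 z -> z = 1%g.
Proof. by move=> /fixes_fromP H; apply/permP => x; rewrite H // perm1. Qed.

Lemma fixes_from_lt (m : 'I_n) z x : fixes_from m.+1 z -> (x <= m)%N -> (z x <= m)%N.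
Proof.
move=> /fixes_fromP H xm; rewrite leqNgt; apply/negP => mz.
by have /perm_inj e := H _ mz; move: mz; rewrite e ltnNge xm.
Qed.

(** The permutation z with m deleted from its cycle. *)
Definition delval z m := swap z ((z^-1)%g m) m.

Section Delval.
Variables (z : 'S_n) (m : 'I_n).
Hypotheses (fz : fixes_from m.+1 z) (zm : z m != m).
Let g := (z^-1)%g m.
Let z' := delval z m.

Lemma delval_g : z g = m. Proof. exact: permKV. Qed.

Lemma delval_gm : g != m.
Proof. by apply: contraNneq zm => e; rewrite -{1}e delval_g. Qed.

Lemma delval_gltm : (g < m)%N.
Proof.
have := delval_gm; rewrite -val_eqE /=; case: ltngtP => // mg _.
by have := delval_gm; rewrite -delval_g (fixes_fromP _ _ fz) ?eqxx.
Qed.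

Lemma delval_zmltm : (z m < m)%N.
Proof. by have := fixes_from_lt fz (leqnn m); rewrite leq_eqVlt val_eqE (negPf zm). Qed.

Lemma delval_Eg : z' g = z m. Proof. exact: swapL. Qed.
Lemma delval_Em : z' m = m. Proof. by rewrite /z' swapR delval_g. Qed.
Lemma delval_E x : x != g -> x != m -> z' x = z x. Proof. exact: swapD. Qed.

Lemma delval_fixes_from : fixes_from m z'.
Proof.
apply/fixes_fromP => x; rewrite leq_eqVlt => /orP[/eqP/val_inj <-|mx]; first exact: delval_Em.
rewrite delval_E -?val_eqE /=; [|have := delval_gltm; lia|lia].
exact: (fixes_fromP _ _ fz).
Qed.

(** Counts the values that keep z from being minimal at m: those that jump over
    the interval between g and z m in the direction from g to z m. *)
Definition excess x : nat :=
  [&& (g <= z m)%N, (x < g)%N & (z m < z x)%N] + [&& (z m <= g)%N, (g < x)%N & (z x < z m)%N].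

(** Compare the pairs that contain g or m.  For each further value x the
    contributions of {x, g} and {x, m} for z and of {x, g} for z' nearly cancel,
    and what is left over is at least twice the excess of x. *)
Lemma height2_delval : height2 z' + 2 + 2%:Z * \sum_x (excess x)%:Z <= height2 z.
Proof.
have gm := delval_gm; have gltm := delval_gltm; have altm := delval_zmltm.
have mltF : (m < g)%N = false by lia.
have maltF : (m < z m)%N = false by lia.
rewrite /height2 !(pair_sum_split2 gm) (sum_split2 gm).
have -> : (excess g)%:Z = 0 by rewrite /excess ltnn !andbF.
have -> : (excess m)%:Z = 0 by rewrite /excess ltnn mltF !andbF.
rewrite (eq_bigr (fun a => \sum_(b | (b != g) && (b != m))
   chi z a * chi z b * (flip z a b : nat)%:Z)); last first.
  move=> a /andP[ag am]; apply: eq_bigr => b /andP[bg bm].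
  by rewrite /chi /flip !delval_E.
set S1 := \sum_(_ | _) \sum_(_ | _) _.
rewrite !flipxx !mulr0 !add0r !addr0.
have E1 : chi z g = 1 by rewrite /chi delval_g gltm (ltnNge m) (ltnW gltm).
have E2 : chi z m = -1 by rewrite /chi altm maltF.
have E4 : chi z' g = ((g < z m)%N : nat)%:Z - ((z m < g)%N : nat)%:Z by rewrite /chi delval_Eg.
have E3 : chi z' m = 0 by rewrite /chi delval_Em ltnn.
rewrite E1 E2 E3 !mulr0 !mul0r !addr0.
have -> : flip z g m by rewrite /flip delval_g gltm maltF.
have -> : flip z m g by rewrite /flip delval_g mltF altm.
have pt a : a != g -> a != m ->
  2%:Z * (excess a)%:Z +
    (chi z a * (flip z a g : nat)%:Z * 2%:Z - chi z a * (flip z a m : nat)%:Z * 2%:Z)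
  <= chi z a * chi z' g * (flip z' a g : nat)%:Z * 2%:Z.
  move=> ag am; rewrite /flip delval_Eg delval_g !delval_E // E4.
  have zag : z a != m :> nat by rewrite -delval_g perm_neq.
  have zam : z a != z m :> nat by rewrite perm_neq.
  have zaM : (a > m)%N -> z a = a by apply: (fixes_fromP _ _ fz).
  have zam' : (a <= m)%N -> (z a <= m)%N by apply: fixes_from_lt.
  move: ag am zag zam; rewrite -!val_eqE /= => ag am zag zam.
  rewrite /chi /excess.
  case: (ltngtP m a) => ma; last by exfalso; lia.
    by rewrite zaM // ltnn subrr !mul0r; lia.
  have {zaM}{}zam' := zam' (ltnW ma).
  by case: (ltngtP a (z a)) => az; case: (ltngtP g (z m)) => gz; lia.
have {pt} : \sum_(a | (a != g) && (a != m)) (2%:Z * (excess a)%:Z +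
  (chi z a * (flip z a g : nat)%:Z * 2%:Z - chi z a * (flip z a m : nat)%:Z * 2%:Z))
  <= \sum_(a | (a != g) && (a != m)) chi z a * chi z' g * (flip z' a g : nat)%:Z * 2%:Z.
  by apply: Num.Theory.ler_sum => a /andP[]; apply: pt.
rewrite big_split /= -mulr_sumr.
set S2 := \sum_(_ | _) (excess _)%:Z.
set S3 := \sum_(_ | _) (_ - _); set S4 := \sum_(_ | _) _ * _ => H.
have -> : \sum_(a | (a != g) && (a != m)) (chi z' a * chi z' g * (flip z' a g : nat)%:Z +
  chi z' a * 0 * (flip z' a m : nat)%:Z
   + chi z' g * chi z' a * (flip z' g a : nat)%:Z + 0 * chi z' a * (flip z' m a : nat)%:Z) = S4.
  apply: eq_bigr => a /andP[ag am].
  have ca : chi z' a = chi z a by rewrite /chi delval_E.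
  by rewrite (flip_sym _ g a) ca; ring.
have -> : \sum_(a | (a != g) && (a != m)) (chi z a * 1 * (flip z a g : nat)%:Z +
  chi z a * -1 * (flip z a m : nat)%:Z
   + 1 * chi z a * (flip z g a : nat)%:Z + -1 * chi z a * (flip z m a : nat)%:Z) = S3.
  by apply: eq_bigr => a _; rewrite (flip_sym _ g a) (flip_sym _ m a); ring.
have -> : 1 * -1 * (true : nat)%:Z + -1 * 1 * (true : nat)%:Z = - 2%:Z by [].
move: H; rewrite opprD opprD !opprK; lia.
Qed.
End Delval.
End Removal.

(** * Supports, cycles and minimal permutations *)

Section Stats.
Variable n : nat.
Implicit Types (u v w z : 'S_n) (i j x y m g : 'I_n).

(** Every permutation is built from the identity by inserting values into cycles
    in increasing order. *)
Lemma delval_ind (P : 'S_n -> Prop) :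
  P 1%g -> (forall z m, fixes_from m.+1 z -> z m != m -> P (delval z m) -> P z) ->
    forall z, P z.
Proof.
move=> P1 Prem z.
suff H (m : nat) : (m <= n)%N -> forall z, fixes_from m z -> P z.
  by apply: (H n (leqnn n) z); apply/fixes_fromP => x; rewrite leqNgt ltn_ord.
elim: m {z} => [|m IH] mn z fz; first by rewrite (fixes_from0 fz).
pose m' := Ordinal mn; case: (eqVneq (z m') m') => [zm|zm]; last first.
  exact: (Prem z m' fz zm (IH (ltnW mn) _ (@delval_fixes_from _ z m' fz zm))).
apply: IH (ltnW mn) _ _; apply/fixes_fromP => x; rewrite leq_eqVlt => /orP[/eqP mx|mx].
  by have -> : x = m' by apply: val_inj.
exact: (fixes_fromP _ _ fz).
Qed.

Lemma im_porbit z x : z x \in porbit z x.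
Proof. by have := mem_porbit z 1 x; rewrite expg1. Qed.

Lemma porbit_fix z x : z x = x -> porbit z x = [set x].
Proof.
move=> zx; apply/setP => y; rewrite inE; apply/porbitP/eqP => [[i ->]|->]; last first.
  by exists 0%N; rewrite expg0 perm1.
by elim: i => [|i IH]; rewrite ?expg0 ?perm1 // expgSr permM IH.
Qed.

(** Ties the number of nontrivial cycles to the number of all orbits, for which
    the effect of multiplication by a transposition is known. *)
Lemma porbits_pcycles z : (#|porbits z| + #|psupp z|)%N = (pcycles z + n)%N.
Proof.
rewrite -(cardsID [set c : {set 'I_n} | (1 < #|c|)%N] (porbits z)) -addnA.
have -> : #|porbits z :&: [set c : {set 'I_n} | (1 < #|c|)%N]| = pcycles z.
  by apply: eq_card => c; rewrite !inE.
congr (_ + _)%N; transitivity (#|~: psupp z| + #|psupp z|)%N; last first.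
  by rewrite addnC cardsC card_ord.
congr (_ + _)%N; rewrite -(card_imset (~: psupp z) (@set1_inj _)).
apply: eq_card => c; rewrite !inE; apply/andP/imsetP => [[c1 /imsetP[x _ cE]]|[x]].
  exists x; last rewrite cE.
    rewrite !inE negbK; apply: contraNT c1 => zx; rewrite cE.
    have : [set x; z x] \subset porbit z x.
      by rewrite subUset !sub1set porbit_id im_porbit.
    by move/subset_leq_card; rewrite cards2 eq_sym zx.
  apply: porbit_fix; apply/eqP; apply: contraNT c1 => zx; rewrite cE.
  have : [set x; z x] \subset porbit z x.
    by rewrite subUset !sub1set porbit_id im_porbit.
  by move/subset_leq_card; rewrite cards2 eq_sym zx.
rewrite !inE negbK => /eqP zx ->; rewrite cards1; split=> //.
by apply/imsetP; exists x => //; rewrite porbit_fix.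
Qed.

Section Delval.
Variables (z : 'S_n) (m : 'I_n).
Hypotheses (fz : fixes_from m.+1 z) (zm : z m != m).
Let g := (z^-1)%g m.
Let z' := delval z m.

Lemma porbits_delval : #|porbits z'| = (#|porbits z|).+1.
Proof.
have := porbits_mul_tperm z g m; rewrite -/z' (delval_gm zm) addn1.
have -> : g \in porbit z m.
  by rewrite porbit_sym -[X in X \in _](permKV z) im_porbit.
by rewrite /= addn0.
Qed.

Lemma psupp_delval : #|psupp z| = (#|psupp z'| + 1 + (z m == g))%N.
Proof.
have gm : g != m := delval_gm zm.
have zg : z g = m by apply: delval_g.
rewrite (cardsD1 m) inE zm (cardsD1 g (psupp z :\ m)) !inE zg gm eq_sym gm /=.
have -> : #|psupp z'| = ((z m != g) + #|psupp z :\ m :\ g|)%N.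
  rewrite (cardsD1 g) inE delval_Eg; congr (_ + _)%N; apply: eq_card => x.
  rewrite !inE; case: eqVneq => //= xg; case: (eqVneq x m) => [->|xm] /=.
    by rewrite delval_Em eqxx.
  by rewrite delval_E.
by case: eqP => /= _; clear fz; lia.
Qed.

Lemma pht_delval : pht z = (pht z' + (z m <= g)%N)%N.
Proof.
have gltm := delval_gltm fz zm; have altm := delval_zmltm fz zm.
have gm : g != m := delval_gm zm.
have zg : z g = m by apply: delval_g.
rewrite /pht (cardsD1 g) inE zg gltm.
rewrite [in RHS](cardsD1 g) inE delval_Eg.
have -> : #|[set i : 'I_n | (i < z i)%N] :\ g| = #|[set i : 'I_n | (i < z' i)%N] :\ g|.
  apply: eq_card => x; rewrite !inE; case: eqVneq => //= xg.
  case: (eqVneq x m) => [->|xm]; first by rewrite delval_Em ltnn; lia.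
  by rewrite delval_E.
by rewrite (leqNgt (z m)); case: (g < z m)%N => /=; rewrite ?addn0 ?add0n ?add1n ?addn1.
Qed.

Lemma pcycles_delval : pcycles z = (pcycles z' + (z m == g))%N.
Proof.
have := porbits_pcycles z; have := porbits_pcycles z'.
by rewrite porbits_delval psupp_delval; clear fz; lia.
Qed.

Lemma delval_eq1 : (z' == 1%g) -> z m = g.
Proof. by move/eqP => z1; have := delval_Eg z m; rewrite -/z' z1 perm1. Qed.
End Delval.

Lemma psupp1 : #|psupp (1 : 'S_n)%g| = 0%N.
Proof. by apply: eq_card0 => x; rewrite !inE perm1 eqxx. Qed.

Lemma pht1 : pht (1 : 'S_n)%g = 0%N.
Proof. by apply: eq_card0 => x; rewrite !inE perm1 ltnn. Qed.

Lemma pcycles1 : pcycles (1 : 'S_n)%g = 0%N.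
Proof.
apply: eq_card0 => c; rewrite !inE; apply/negP => /andP[/imsetP[x _ ->]].
by rewrite porbit_fix ?perm1 // cards1.
Qed.

Lemma height21 : height2 (1 : 'S_n)%g = 0.
Proof.
rewrite /height2 big1 ?oppr0 // => x _; rewrite big1 // => y _.
by rewrite /chi perm1 ltnn mul0r mul0r.
Qed.

Lemma pcycles_pht z : (pcycles z <= pht z)%N.
Proof.
elim/delval_ind: z => [|z m fz zm IH]; first by rewrite pcycles1.
rewrite (pcycles_delval zm) (pht_delval fz zm) leq_add //.
by case: eqP => // ->; rewrite leqnn.
Qed.

Lemma pcycles_pdown z : (pht z + pcycles z <= #|psupp z|)%N.
Proof.
elim/delval_ind: z => [|z m fz zm IH]; first by rewrite pcycles1 pht1.
rewrite (pcycles_delval zm) (pht_delval fz zm) (psupp_delval zm).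
by move: IH; rewrite -val_eqE /=; case: ltngtP; lia.
Qed.

Lemma pcycles_gt0 z : z != 1%g -> (0 < pcycles z)%N.
Proof.
elim/delval_ind: z => [|z m fz zm IH]; first by rewrite eqxx.
rewrite (pcycles_delval zm); case: (eqVneq (delval z m) 1%g) => [/eqP/delval_eq1 ->|/IH];
  last by lia.
by rewrite eqxx; lia.
Qed.

(** Twice the least number of transpositions with product z. *)
Definition rank2 z : int := 2%:Z * ((#|psupp z|)%:Z - (pcycles z)%:Z).

Lemma rank2_delval z m : z m != m -> rank2 z = rank2 (delval z m) + 2.
Proof. by move=> zm; rewrite /rank2 (psupp_delval zm) (pcycles_delval zm); lia. Qed.

(** Inserting a value raises the rank by one and the height by at least one. *)
Lemma rank2_le_height2 z : rank2 z <= height2 z.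
Proof.
elim/delval_ind: z => [|z m fz zm IH].
  by rewrite height21 /rank2 psupp1 pcycles1.
have := height2_delval fz zm; rewrite (rank2_delval zm).
have : 0 <= \sum_x (excess z m x)%:Z by apply: Num.Theory.sumr_ge0.
lia.
Qed.

(** Equality in the lower bound for the height passes to the shortened
    permutation and leaves no room for excess. *)
Lemma minimal_delval z m : fixes_from m.+1 z -> z m != m -> height2 z = rank2 z ->
  height2 (delval z m) = rank2 (delval z m) /\ forall x, excess z m x = 0%N.
Proof.
move=> fz zm E; have := height2_delval fz zm; rewrite E (rank2_delval zm).
have := rank2_le_height2 (delval z m).
have ge0 : 0 <= \sum_x (excess z m x)%:Z by apply: Num.Theory.sumr_ge0.
move=> H1 H2; split; first by lia.
have E0 : \sum_x (excess z m x)%:Z = 0 by lia.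
move=> x; move: E0; rewrite (bigD1 x) //=.
set s := (X in _ + X); have : 0 <= s by apply: Num.Theory.sumr_ge0.
lia.
Qed.
End Stats.

(** * Minimal intervals of the k-Bruhat order *)

Section MinimalPairs.
Variable n : nat.
Implicit Types (u v w z : 'S_n) (i j x y m g : 'I_n).

(** The pairs u <=_k w with w u^-1 (that is, (u^-1 * w)%g) minimal and moving only
    values less than m;
    kcrit instead of a chain makes the induction on m possible. *)
Definition minimal_pair (k m : nat) u w :=
  [&& kcrit k u w, fixes_from m (u^-1 * w)%g & height2 (u^-1 * w)%g == rank2 (u^-1 * w)%g].

Lemma ratioE u w x : (u^-1 * w)%g (u x) = w x.
Proof. by rewrite permM permK. Qed.

Section Step.
Variables (k : nat) (u w : 'S_n) (m i j : 'I_n).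
Hypotheses (uj : u j = m) (wi : w i = m).
Let z := (u^-1 * w)%g.

Lemma ratio_m : z m = w j. Proof. by rewrite -uj ratioE. Qed.

Lemma ratio_invm : (z^-1)%g m = u i.
Proof. by apply: (@perm_inj _ z); rewrite permKV ratioE. Qed.

Lemma delval_ratio : delval z m = (u^-1 * swap w i j)%g.
Proof.
apply/permP => x; rewrite -(permKV u x); set y := (u^-1)%g x.
rewrite ratioE /delval ratio_invm -uj swapE -inj_tperm; last exact: perm_inj.
by rewrite ratioE swapE.
Qed.

Lemma swap_ratio : (u^-1 * swap w i j)%g = ((swap u i j)^-1 * w)%g.
Proof. by rewrite /swap invMg tpermV mulgA. Qed.

(** A minimal interval that moves m has a chain whose last or first step has
    label m.  Which of them depends on the order of the values u i and w j
    before and after m in its cycle; both exist if these coincide.  Absence of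
    excess provides the empty rectangle of the step as well as the inequalities
    for the remaining interval. *)
Lemma minimal_pair_split : i != j -> minimal_pair k m.+1 u w ->
  [/\ (i < k)%N, (k <= j)%N,
   (u i <= w j)%N -> cov (swap w i j) i j && minimal_pair k m u (swap w i j) &
   (w j <= u i)%N -> cov u i j && minimal_pair k m (swap u i j) w].
Proof.
move=> ij /and3P[/kcritP[H1 H2 H3] fz /eqP mz].
have zm : z m != m by rewrite ratio_m -wi (inj_eq perm_inj) eq_sym.
have gm : (u i < m)%N by have := delval_gltm fz zm; rewrite ratio_invm.
have am : (w j < m)%N by have := delval_zmltm fz zm; rewrite ratio_m.
have [mz' ex] := minimal_delval fz zm mz.
have fz' := delval_fixes_from fz zm.
have ik : (i < k)%N by case: ltnP => // /H2; rewrite wi; lia.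
have kj : (k <= j)%N by case: leqP => // /H1; rewrite uj; lia.
have lij : (i < j)%N by lia.
have ujN : u j = m :> nat by rewrite uj.
have wiN : w i = m :> nat by rewrite wi.
have Fb x : (m < u x)%N -> w x = u x :> nat.
  by move=> mx; rewrite -(ratioE u w) (fixes_fromP _ _ fz).
have Fc x : (u x <= m)%N -> (w x <= m)%N.
  by move=> mx; rewrite -(ratioE u w); apply: fixes_from_lt fz mx.
(* The two forms of vanishing excess, in terms of positions. *)
have Fd x : (u i <= w j)%N -> (u x < u i)%N -> (w j < w x)%N -> False.
  move=> a1 a2 a3; have := ex (u x).
  by rewrite /excess ratio_invm ratio_m ratioE a1 a2 a3.
have Fe x : (w j <= u i)%N -> (u i < u x)%N -> (w x < w j)%N -> False.
  move=> a1 a2 a3; have := ex (u x).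
  by rewrite /excess ratio_invm ratio_m ratioE a1 a2 a3 /= addn1.
have Fi x : (x != i :> nat) -> (u x != u i :> nat) && (w x != w i :> nat).
  by move=> xi; rewrite !perm_neq.
have Fj x : (x != j :> nat) -> (u x != u j :> nat) && (w x != w j :> nat).
  by move=> xj; rewrite !perm_neq.
have sE v x : swap v i j x = if x == i :> nat then v j else if x == j :> nat then v i else v x.
  rewrite !val_eqE swapE; case: tpermP => [->|->|/eqP/negPf-> /eqP/negPf->] //;
    rewrite eqxx //; case: eqP => // ->; done.
have ex2 : delval z m = (u^-1 * swap w i j)%g := delval_ratio.
split=> // [ga|ag].
- apply/andP; split.
    apply/covP; rewrite swapL swapR wi; split=> // x ix xj.
    rewrite sE.
    have -> : (x == i :> nat) = false by lia.
    have -> : (x == j :> nat) = false by lia.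
    move=> wjx wxm; have := Fb x; have := Fd x ga; have := Fi x; have := Fj x.
    have := H3 i x ix; have := H3 x j xj; rewrite uj wi.
    by lia.
  apply/and3P; split; rewrite -?ex2 //; last exact/eqP.
  apply/kcritP; split=> [x xk|x kx|x y xy s uxy]; rewrite !sE.
  - case: eqP => [/val_inj ->|xi]; first by [].
    by case: eqP => [xj|xj]; [lia|apply: H1].
  - case: eqP => [xi|xi]; first by lia.
    by case: eqP => [/val_inj ->|xj]; [rewrite uj wi|apply: H2].
  - have := H3 x y xy s uxy; have := (Fb x, Fb y); have := (Fc x, Fc y).
    have := Fd x ga; have := Fd y ga; have := (Fi x, Fi y); have := (Fj x, Fj y).
    move: s xy uxy => s xy uxy [Fjx Fjy] [Fix Fiy] Fdy Fdx [Fcx Fcy] [Fbx Fby] H3xy.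
    case: (eqVneq (x : nat) i) => [/val_inj ?|?]; case: (eqVneq (y : nat) i) => [/val_inj ?|?];
    case: (eqVneq (x : nat) j) => [/val_inj ?|?]; case: (eqVneq (y : nat) j) => [/val_inj ?|?];
    subst; lia.
- apply/andP; split.
    apply/covP; rewrite uj; split=> // x ix xj.
    move=> uix uxm; have := Fb x; have := Fe x ag; have := Fi x; have := Fj x.
    have := H3 i x ix; have := H3 x j xj; have := Fc x; rewrite uj wi.
    by lia.
  apply/and3P; split; rewrite -?swap_ratio -?ex2 //; last exact/eqP.
  apply/kcritP; split=> [x xk|x kx|x y xy s]; rewrite !sE.
  - case: eqP => [/val_inj ->|xi]; first by rewrite uj wi.
    by case: eqP => [xj|xj]; [lia|apply: H1].
  - case: eqP => [xi|xi]; first by lia.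
    by case: eqP => [/val_inj ->|xj]; [|apply: H2].
  - have H3xy := H3 x y xy s.
    have := (Fb x, Fb y); have := (Fc x, Fc y).
    have := Fe x ag; have := Fe y ag; have := (Fi x, Fi y); have := (Fj x, Fj y).
    move: s xy => s xy [Fjx Fjy] [Fix Fiy] Fdy Fdx [Fcx Fcy] [Fbx Fby].
    case: (eqVneq (x : nat) i) => [/val_inj ?|?]; case: (eqVneq (y : nat) i) => [/val_inj ?|?];
    case: (eqVneq (x : nat) j) => [/val_inj ?|?]; case: (eqVneq (y : nat) j) => [/val_inj ?|?];
    subst; lia.
Qed.

Lemma minimal_pair_height : kcrit k u w -> minimal_pair k m u (swap w i j) ->
  (u i < m)%N -> (w j < m)%N -> plength w = (plength (swap w i j)).+1 ->
  minimal_pair k m.+1 u w.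
Proof.
move=> kuw /and3P[kuv fz' /eqP mz'] uim wjm lw.
have gm : u i != m by rewrite -val_eqE /=; lia.
have zm : z m != m by rewrite ratio_m -val_eqE /=; lia.
apply/and3P; split=> //.
  apply/fixes_fromP => x mx; have := fixes_fromP _ _ fz' x (ltnW mx).
  rewrite -delval_ratio delval_E //; last by rewrite -val_eqE /=; lia.
  by rewrite ratio_invm -val_eqE /=; lia.
apply/eqP; rewrite (rank2_delval zm) delval_ratio -mz'.
by rewrite -(kcrit_height kuw) -(kcrit_height kuv) lw; lia.
Qed.

(** Converse of minimal_pair_split for a last step with label m. *)
Lemma minimal_pair_cov_last : (i < k)%N -> (k <= j)%N ->
  cov (swap w i j) i j -> minimal_pair k m u (swap w i j) ->
  minimal_pair k m.+1 u w /\ (u i <= w j)%N.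
Proof.
move=> ik kj cv gd.
have lw := plength_cov cv; have cu := cov_ltu cv.
have kw := cov_kcrit ik kj cv; rewrite swapK in lw kw; rewrite swapL swapR wi in cu.
have kuv : kcrit k u (swap w i j) by case/and3P: gd.
have uiw : (u i <= w j)%N by have /kcritP[/(_ i ik)] := kuv; rewrite swapL.
split=> //; apply: minimal_pair_height => //; last by lia.
exact: kcrit_trans kuv kw.
Qed.

(** Converse of minimal_pair_split for a first step with label m. *)
Lemma minimal_pair_cov_first : (i < k)%N -> (k <= j)%N ->
  cov u i j -> minimal_pair k m (swap u i j) w ->
  minimal_pair k m.+1 u w /\ (w j <= u i)%N.
Proof.
move=> ik kj cv gd.
have lu := plength_cov cv; have cu := cov_ltu cv; rewrite uj in cu.
have ku := cov_kcrit ik kj cv.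
have /and3P[kvw fz' /eqP mz'] := gd.
have wju : (w j <= u i)%N by have /kcritP[_ /(_ j kj)] := kvw; rewrite swapR.
have kuw := kcrit_trans ku kvw.
have gm : u i != m by rewrite -val_eqE /=; lia.
have zm : z m != m by rewrite ratio_m -val_eqE /=; lia.
rewrite -swap_ratio in fz' mz'.
split=> //; apply/and3P; split=> //.
  apply/fixes_fromP => x mx; have := fixes_fromP _ _ fz' x (ltnW mx).
  rewrite -delval_ratio delval_E //; last by rewrite -val_eqE /=; lia.
  by rewrite ratio_invm -val_eqE /=; lia.
apply/eqP; rewrite (rank2_delval zm) delval_ratio -mz' swap_ratio.
by rewrite -(kcrit_height kuw) -(kcrit_height kvw) lu; lia.
Qed.
End Step.

Lemma minimal_pair_fix k (m : 'I_n) u w : w ((u^-1)%g m) = m ->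
  minimal_pair k m.+1 u w = minimal_pair k m u w.
Proof.
move=> wm; rewrite /minimal_pair; congr [&& _, _ & _];
  apply/fixes_fromP/fixes_fromP => H x mx; last exact/H/ltnW.
move: mx; rewrite leq_eqVlt => /orP[/eqP/val_inj <-|]; last exact: H.
by rewrite permM wm.
Qed.

Lemma minimal_pair_kbruhat k u w : minimal_pair k n u w -> kbruhat k u w.
Proof.
suff H (m : nat) : (m <= n)%N -> forall u w, minimal_pair k m u w -> kbruhat k u w by apply: H.
elim: m {u w} => [|m IH] mn u w.
  by case/and3P => _ /fixes_from0 /(congr1 (mulg u)); rewrite mulKVg mulg1 => ->;
    rewrite /kbruhat connect0.
pose m' := Ordinal mn; pose i := (w^-1)%g m'; pose j := (u^-1)%g m'.
have uj : u j = m' by rewrite permKV.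
have wi : w i = m' by rewrite permKV.
case: (eqVneq i j) => [ij|ij] gd.
  by apply: (IH (ltnW mn)); rewrite -(@minimal_pair_fix k m') // -/j -ij.
have [ik kj H1 H2] := minimal_pair_split uj wi ij gd.
case: (leqP (u i) (w j)) => [/H1 /andP[cv g]|/ltnW/H2 /andP[cv g]].
  apply: connect_trans (IH (ltnW mn) _ _ g) _.
  by have := cov_kbruhat ik kj cv; rewrite swapK.
exact: connect_trans (cov_kbruhat ik kj cv) (IH (ltnW mn) _ _ g).
Qed.

Lemma minimal_pair_full k u w : minimal_pair k n u w =
  kbruhat k u w && (height2 (u^-1 * w)%g == rank2 (u^-1 * w)%g).
Proof.
apply/idP/andP => [g|[kuw mz]]; first by split; [exact: minimal_pair_kbruhat|case/and3P: g].
apply/and3P; split=> //; first exact: kbruhat_kcrit.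
by apply/fixes_fromP => x; rewrite leqNgt ltn_ord.
Qed.

Lemma minimal_pair_refl k m u : minimal_pair k m u u.
Proof.
apply/and3P; split; first exact: kcrit_refl.
  by rewrite mulVg; apply/fixes_fromP => x; rewrite perm1.
by rewrite mulVg height21 /rank2 psupp1 pcycles1.
Qed.

(** The height is well defined because every pair that may be picked yields the
    same number height2 z. *)
Lemma kheightE (k : nat) u z : (k <= n)%N -> kbruhat k u (permcomp z u) ->
  2%:Z * (kheight z)%:Z = height2 z.
Proof.
have key k' v : kbruhat k' v (permcomp z v) ->
    2%:Z * ((plength (permcomp z v))%:Z - (plength v)%:Z) = height2 z.
  by move/kbruhat_kcrit/kcrit_height; rewrite /permcomp mulKg.
move=> kn kuz; rewrite /kheight;
  case: pickP => [[v k'] /= H|/(_ (u, Ordinal (kn : k < n.+1)%N))]; last by rewrite /= kuz.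
have E := key _ _ H; have := rank2_le_height2 z; have := pcycles_pdown z.
by rewrite /rank2; lia.
Qed.

Lemma pminimalE (k : nat) u z : (k <= n)%N -> kbruhat k u (permcomp z u) ->
  pminimal z = (height2 z == rank2 z).
Proof.
move=> kn kuz; have := kheightE kn kuz; have := pcycles_pdown z.
by rewrite /pminimal /rank2 => H <-; lia.
Qed.
End MinimalPairs.

(** * Matrix entries of the peakless operator *)

Section Entries.
Variables (n : nat) (K : comNzRingType) (t q : K).
Implicit Types (u v w z : 'S_n) (i j x y m g : 'I_n).
Notation V := {ffun 'S_n -> K^o}.
Implicit Types f : V.

(** For z other than the identity, t + q times this is the product over the
    nontrivial cycles of (t + q) t^(d - 1) q^(h - 1), for a cycle with d values
    moving down and h values moving up. *)
Definition peakless_weight z : K := if z == 1%g then 0 else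
  t ^+ (#|psupp z| - pht z - pcycles z) * q ^+ (pht z - pcycles z)
  * (t + q) ^+ (pcycles z).-1.

(** Deleting m from a longer cycle removes a down move if g < z m and an up move
    if z m < g; a 2-cycle disappears with its factor t + q. *)
Lemma peakless_weight_delval z m : fixes_from m.+1 z -> z m != m ->
  let g := (z^-1)%g m in
  peakless_weight z = (if (g <= z m)%N then t * peakless_weight (delval z m) else 0)
       + (if (z m <= g)%N then q * peakless_weight (delval z m) else 0)
       + (if delval z m == 1%g then 1 else 0).
Proof.
move=> fz zm g; have z1 : z != 1%g by apply: contraNneq zm => ->; rewrite perm1.
rewrite /peakless_weight (negPf z1).
have c1 := pcycles_delval zm; have p1 := pht_delval fz zm; have s1 := psupp_delval zm.
case: (eqVneq (delval z m) 1%g) => [e|ne].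
  move: c1 p1 s1; have /eqP/delval_eq1 eg := e; rewrite eg e pcycles1 pht1 psupp1 eqxx leqnn.
  by move=> -> -> -> /=; rewrite !expr0 !mulr0 !mul1r !add0r.
have c' := pcycles_gt0 ne; have pc' := pcycles_pht (delval z m);
  have dc' := pcycles_pdown (delval z m).
rewrite addr0; move: c1 p1 s1.
rewrite -/g -(inj_eq val_inj) /=.
move: (pcycles (delval z m)) (pht (delval z m)) #|psupp (delval z m)| c' pc' dc' =>
  c h s c0 ch hcs.
case: ltngtP => gz /= -> -> ->; rewrite ?addn0 ?addr0 ?add0r.
- rewrite (_ : s + 1 - (h + 1) - c = s - h - c)%N; last by lia.
  rewrite (_ : h + 1 - c = (h - c).+1)%N; last by lia.
  by rewrite exprS; ring.
- rewrite (_ : s + 1 - h - c = (s - h - c).+1)%N; last by lia.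
  by rewrite exprS; ring.
- rewrite (_ : s + 1 + 1 - (h + 1) - (c + 1) = s - h - c)%N; last by lia.
  rewrite (_ : h + 1 - (c + 1) = h - c)%N; last by lia.
  rewrite (_ : (c + 1).-1 = c.-1.+1)%N; last by lia.
  by rewrite exprS; ring.
Qed.

Definition peakless_coef (k m : nat) u w : K :=
  if minimal_pair k m u w then peakless_weight (u^-1 * w)%g else 0.

Lemma peakless_weight1 : peakless_weight 1%g = 0. Proof. by rewrite /peakless_weight eqxx. Qed.

Lemma peakless_coef_fix k (m : 'I_n) u w j : peakless_coef k m u w != 0 -> u j = m -> w j = m.
Proof.
rewrite /peakless_coef; case: ifP; rewrite ?eqxx // => /and3P[_ /fixes_fromP H _] _ uj.
by rewrite -(ratioE u w) uj H.
Qed.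

(** Contribution of chains whose first or last step exchanges the positions i
    and j, where j is the position of m in u. *)
Definition cstep k (m : nat) u w i j : K := if (i < k <= j)%N then
   t * (if cov (swap w i j) i j then peakless_coef k m u (swap w i j) else 0)
   + q * (if cov u i j then peakless_coef k m (swap u i j) w else 0)
   + (if cov u i j && (w == swap u i j) then 1 else 0) else 0.

Lemma cstep_off k (m : 'I_n) u w i j : u j = m -> w i != m -> cstep k m u w i j = 0.
Proof.
move=> uj wi; rewrite /cstep; case: ifP => // /andP[ik kj].
have -> : peakless_coef k m u (swap w i j) = 0.
  by apply/eqP; apply: contraNT wi => /peakless_coef_fix /(_ uj); rewrite swapR => ->.
have -> : peakless_coef k m (swap u i j) w = 0.
  apply/eqP; apply: contraNT wi => /peakless_coef_fix H; apply/eqP/H.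
  by rewrite swapL.
rewrite !if_same !mulr0 !add0r; case: ifP => // /andP[_ /eqP wE].
by move: wi; rewrite wE swapL uj eqxx.
Qed.

(** Only the position i of m in w contributes to the sum.  If m does not move
    nothing is added; otherwise minimal_pair_split and its converses match the
    three cases of peakless_weight_delval. *)
Lemma peakless_coef_rec k (m : 'I_n) u w j : u j = m ->
  peakless_coef k m.+1 u w = peakless_coef k m u w + \sum_i cstep k m u w i j.
Proof.
move=> uj; pose i := (w^-1)%g m; have wi : w i = m by rewrite permKV.
rewrite (bigD1 i) //= big1 ?addr0; last first.
  move=> i' ni; apply: cstep_off => //; apply: contraNneq ni => wi'.
  by apply/eqP/(@perm_inj _ w); rewrite wi' wi.
have uE : (u^-1)%g m = j by apply: (@perm_inj _ u); rewrite permKV.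
clearbody i; case: (eqVneq i j) => [ij|ij].
  rewrite /cstep ij; case: ifP => [/andP[]|_]; first by lia.
  by rewrite addr0 /peakless_coef minimal_pair_fix // uE -ij.
have zmE : (u^-1 * w)%g m = w j by rewrite -uj ratioE.
have zm : (u^-1 * w)%g m != m.
  by rewrite zmE -wi (inj_eq perm_inj) eq_sym.
have -> : peakless_coef k m u w = 0.
  apply/eqP; apply: contraNT zm => /peakless_coef_fix /(_ uj).
  by rewrite zmE => ->.
have dE := delval_ratio uj wi; have sE := swap_ratio u w i j.
have gE := ratio_invm u wi.
rewrite add0r /cstep {1}/peakless_coef; case: ifP => [gd|gd].
  have [ik kj H1 H2] := minimal_pair_split uj wi ij gd; rewrite ik kj /=.
  have fz : fixes_from m.+1 (u^-1 * w)%g by case/and3P: gd.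
  rewrite (peakless_weight_delval fz zm) /= gE zmE dE.
  have one : (u^-1 * swap w i j == 1)%g = (w == swap u i j).
    by rewrite -eq_mulVg1 eq_sym -(inj_eq (mulgI (tperm i j))) -!/(swap _ i j) swapK.
  rewrite one; congr (_ + _ + _).
  - case: (leqP (u i) (w j)) => [/H1/andP[cv g]|lt]; first by rewrite cv /peakless_coef g.
    case: ifP => cv; last by rewrite mulr0.
    rewrite /peakless_coef; case: ifP => g; last by rewrite mulr0.
    by have [_] := minimal_pair_cov_last uj wi ik kj cv g; lia.
  - case: (leqP (w j) (u i)) => [/H2/andP[cv g]|lt]; first by rewrite cv /peakless_coef g sE.
    case: ifP => cv; last by rewrite mulr0.
    rewrite /peakless_coef; case: ifP => g; last by rewrite mulr0.
    by have [_] := minimal_pair_cov_first uj wi ik kj cv g; lia.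
  - case: (eqVneq w (swap u i j)) => [wE|]; last by rewrite andbF.
    rewrite andbT; have : (w j <= u i)%N by rewrite wE swapR.
    by case/H2/andP => ->.
case: ifP => // /andP[ik kj].
have -> : (if cov (swap w i j) i j then peakless_coef k m u (swap w i j) else 0) = 0.
  case: ifP => // cv; rewrite /peakless_coef; case: ifP => // g.
  by have [] := minimal_pair_cov_last uj wi ik kj cv g; rewrite gd.
have -> : (if cov u i j then peakless_coef k m (swap u i j) w else 0) = 0.
  case: ifP => // cv; rewrite /peakless_coef; case: ifP => // g.
  by have [] := minimal_pair_cov_first uj wi ik kj cv g; rewrite gd.
rewrite !mulr0 !add0r; case: ifP => // /andP[cv /eqP wE].
have [] := minimal_pair_cov_first uj wi ik kj cv; last by rewrite gd.
by rewrite -wE minimal_pair_refl.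
Qed.

Lemma label_op_sum k (m : 'I_n) f u j : u j = m ->
  label_op k m f u = \sum_(i : 'I_n) if (i < k <= j)%N && cov u i j then f (swap u i j) else 0.
Proof.
move=> uj; rewrite -uj; case: (leqP k j) => kj; last first.
  by rewrite label_op_off // big1 // => i _; rewrite andbF.
rewrite label_op_at // big_mkcond; apply: eq_bigr => i _; rewrite andbT ffunE.
by case: (i < k)%N.
Qed.

(** The peakless operator counts minimal intervals: no others have peakless
    chains.  The two sides satisfy the same recursion in m; a label m cannot be
    used twice, so the term of degree 2 in label_op k m vanishes. *)
Lemma peakless_opE k (m : nat) f u : (m <= n)%N ->
  peakless_op t q k m f u = \sum_w peakless_coef k m u w * f w.
Proof.
elim: m f u => [|m IH] f u mn.
  rewrite /= ffunE big1 // => w _; rewrite /peakless_coef; case: ifP; rewrite ?mul0r //.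
  by case/and3P => _ /fixes_from0 -> _; rewrite peakless_weight1 mul0r.
have {}IH f' u' : peakless_op t q k m f' u' =
  \sum_w peakless_coef k m u' w * f' w by apply: IH (ltnW mn).
pose m' := Ordinal mn; pose j := (u^-1)%g m'; have uj : u j = m' by rewrite permKV.
clearbody j.
have -> : peakless_op t q k m.+1 f =
  (peakless_op t q k m f + t *: peakless_op t q k m (label_op k m f))
   + (q *: label_op k m (peakless_op t q k m f) +
     q *: (t *: label_op k m (peakless_op t q k m (label_op k m f)))) + label_op k m f.
  by rewrite /= linearD linearZ /= linearD linearZ /= scalerDr.
have -> : label_op k m (peakless_op t q k m (label_op k m f)) = 0.
  apply/ffunP => v; pose jv := (v^-1)%g m'; have vj : v jv = m' by rewrite permKV.
  rewrite (@label_op_sum k m' _ v jv) // ffunE big1 // => i _;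
    case: ifP => // /andP[/andP[ik kj] cv].
  rewrite IH big1 // => w _;
    have [->|nz] := eqVneq (peakless_coef k m (swap v i jv) w) 0; first by rewrite mul0r.
  have wi : w i = m' by apply: (@peakless_coef_fix k m' (swap v i jv)); rewrite ?swapL.
  rewrite (_ : m = w i :> nat); last by rewrite wi.
  by rewrite label_op_off // mulr0.
rewrite !scaler0 addr0 !ffunE.
have scaleK (c d : K) : c *: (d : K^o) = c * d by [].
rewrite !scaleK !(@label_op_sum k m' _ u j) // !IH.
under [RHS]eq_bigr do rewrite (@peakless_coef_rec k m' u _ j) // mulrDl mulr_suml.
rewrite big_split /= -!addrA; congr (_ + _).
have -> : \sum_v peakless_coef k m u v * label_op k m f v =
    \sum_(i : 'I_n) \sum_w (if (i < k <= j)%N && cov (swap w i j) i j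
                    then peakless_coef k m u (swap w i j) * f w else 0).
  rewrite [RHS]exchange_big /=.
  transitivity (\sum_v \sum_(i : 'I_n) if (i < k <= j)%N && cov v i j
                    then peakless_coef k m u v * f (swap v i j) else 0).
    apply: eq_bigr => v _; have [->|nz] := eqVneq (peakless_coef k m u v) 0.
      by rewrite mul0r big1 // => i _; rewrite mul0r if_same.
    rewrite (@label_op_sum k m' _ v j); last exact: (@peakless_coef_fix k m' u v j nz).
    by rewrite mulr_sumr; apply: eq_bigr => i _; case: ifP; rewrite ?mulr0.
  rewrite exchange_big [RHS]exchange_big /=; apply: eq_bigr => i _.
  have inj : injective (fun w : 'S_n => swap w i j).
    by move=> w w' /(congr1 (fun w => swap w i j)); rewrite !swapK.
  rewrite (reindex_inj inj) /=; apply: eq_bigr => w _.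
  by rewrite swapK.
rewrite [RHS]exchange_big /= !mulr_sumr -!big_split /=; apply: eq_bigr => i _.
rewrite /cstep; case: (i < k <= j)%N => /=; last first.
  by rewrite big1 // !mulr0 !addr0 big1 // => w _; rewrite mul0r.
under [RHS]eq_bigr do rewrite mulrDl mulrDl.
rewrite !big_split /= -addrA; congr (_ + (_ + _)).
- rewrite mulr_sumr; apply: eq_bigr => w _.
  by case: ifP => _; rewrite ?mulr0 ?mul0r // mulrA.
- case: ifP => _; last by rewrite mulr0 big1 // => w _; rewrite ?mulr0 mul0r.
  by rewrite IH mulr_sumr; apply: eq_bigr => w _; rewrite mulrA.
- case: ifP => _ /=; last by rewrite big1 // => w _; rewrite mul0r.
  rewrite (bigD1 (swap u i j)) //= eqxx mul1r big1 ?addr0 // => w /negPf->.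
  by rewrite mul0r.
Qed.
End Entries.

(** * Divided differences *)

Local Opaque divdiff msym.

Section RingIdentities.
Variable K : comNzRingType.
Implicit Types a b c d x y z A B : K.

Lemma sub_sub_exchange a b c d : a - b - (c - d) = a - c - (b - d).
Proof. ring. Qed.

Lemma quotient_add A a b x y c d :
  A * x = a - c -> A * y = b - d -> A * (x + y) = a + b - (c + d).
Proof. by rewrite mulrDr => -> ->; ring. Qed.

Lemma quotient_opp A a x c : A * x = a - c -> A * - x = - a - - c.
Proof. by rewrite mulrN => ->; ring. Qed.

Lemma quotient_leibniz A a b x y c d :
  A * x = a - c -> A * y = b - d -> A * (x * b + c * y) = a * b - c * d.
Proof. by rewrite mulrDr mulrA mulrCA => -> ->; ring. Qed.

Lemma triple_identity A B f sf rf rsf srf srsf X Y Z sY rZ srZ :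
  A * Z = f - sf -> B * Y = Z - rZ -> A * X = Y - sY ->
  (A + B) * sY = Z - srZ -> (A + B) * rZ = rf - rsf -> B * srZ = srf - srsf ->
  A * B * (A + B) * X = f - sf - rf + rsf + srf - srsf.
Proof.
move=> EZ EY EX E1 E2 E3.
transitivity (A * Z - (A + B) * rZ + B * srZ); last by rewrite EZ E2 E3; ring.
transitivity (B * (A + B) * (A * X)); first by ring.
rewrite EX; transitivity ((A + B) * (B * Y) - B * ((A + B) * sY)); first by ring.
by rewrite EY E1; ring.
Qed.

Lemma alternating_exchange a b c d x y :
  a - b - c + d + x - y = a - c - b + x + d - y.
Proof. ring. Qed.
End RingIdentities.


Section DivDiff.
Variable n : nat.
Notation R := {mpoly int[n]}.
Implicit Types (f g p : R) (i j l x : 'I_n) (u v w : 'S_n).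

Lemma msym_tpermX i j l : msym (tperm i j) 'X_l = 'X_(tperm i j l) :> R.
Proof.
rewrite msymX; congr mpolyX; apply/mnmP=> m; rewrite mnmE !mnm1E tpermV.
by rewrite -(inj_eq (@perm_inj _ (tperm i j))) tpermK.
Qed.

Lemma XB_neq0 i j : i != j -> 'X_i - 'X_j != 0 :> R.
Proof.
move=> ij; apply/eqP => /(congr1 (fun p : R => p@_U_(i))).
by rewrite mcoeffB !mcoeffX mcoeff0 eqxx eq_mnm1 eq_sym (negPf ij) subr0.
Qed.

(** The quotient is unique in an integral domain, so identities of divided
    differences are checked after multiplication by 'X_i - 'X_j. *)
Lemma divdiff_eq i j f g : i != j ->
  ('X_i - 'X_j) * g = f - msym (tperm i j) f -> divdiff i j f = g.
Proof. by move=> ij; rewrite -divdiffP => /(mulfI (XB_neq0 ij)) ->. Qed.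

Lemma divdiffD i j f g : i != j -> divdiff i j (f + g) = divdiff i j f + divdiff i j g.
Proof.
move=> ij; apply: divdiff_eq => //; rewrite msymD.
exact: quotient_add (divdiffP i j f) (divdiffP i j g).
Qed.

Lemma divdiffN i j f : i != j -> divdiff i j (- f) = - divdiff i j f.
Proof.
move=> ij; apply: divdiff_eq => //; rewrite msymN.
exact: quotient_opp (divdiffP i j f).
Qed.

Lemma divdiff0 i j : i != j -> divdiff i j 0 = 0.
Proof. by move=> ij; apply: divdiff_eq => //; rewrite msym0 mulr0 subrr. Qed.

Lemma divdiffM i j f g : i != j ->
  divdiff i j (f * g) = divdiff i j f * g + msym (tperm i j) f * divdiff i j g.
Proof.
move=> ij; apply: divdiff_eq => //; rewrite msymM.
exact: quotient_leibniz (divdiffP i j f) (divdiffP i j g).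
Qed.

Lemma divdiff_sum i j (I : finType) (P : pred I) (F : I -> R) : i != j ->
  divdiff i j (\sum_(a | P a) F a) = \sum_(a | P a) divdiff i j (F a).
Proof.
move=> ij; apply: (big_morph (divdiff i j)); last exact: divdiff0.
by move=> f g; apply: divdiffD.
Qed.

Lemma divdiff_fixed i j f : i != j -> msym (tperm i j) f = f -> divdiff i j f = 0.
Proof. by move=> ij sf; apply: divdiff_eq => //; rewrite sf mulr0 subrr. Qed.

Lemma msym_tpermK i j f : msym (tperm i j) (msym (tperm i j) f) = f.
Proof. by rewrite -msymMm tperm2 msym1m. Qed.

Lemma msym_divdiff i j f : i != j -> msym (tperm i j) (divdiff i j f) = divdiff i j f.
Proof.
move=> ij; apply: (mulfI (XB_neq0 ij)); rewrite divdiffP.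
have -> : 'X_i - 'X_j = - msym (tperm i j) ('X_i - 'X_j) :> R.
  by rewrite msymB !msym_tpermX tpermL tpermR opprB.
by rewrite mulNr -msymM divdiffP msymB msym_tpermK opprB.
Qed.

Lemma divdiff_divdiff i j f : i != j -> divdiff i j (divdiff i j f) = 0.
Proof. by move=> ij; apply: divdiff_fixed => //; apply: msym_divdiff. Qed.

Lemma divdiffXl i j : i != j -> divdiff i j 'X_i = 1.
Proof. by move=> ij; apply: divdiff_eq => //; rewrite msym_tpermX tpermL mulr1. Qed.

Lemma divdiffXr i j : i != j -> divdiff i j 'X_j = -1.
Proof. by move=> ij; apply: divdiff_eq => //; rewrite msym_tpermX tpermR mulrN1 opprB. Qed.

Lemma divdiffX i j l : i != j -> l != i -> l != j -> divdiff i j 'X_l = 0.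
Proof.
by move=> ij li lj; apply: divdiff_fixed => //; rewrite msym_tpermX tpermD // eq_sym.
Qed.

Lemma divdiff_commute i j k l f : i != j -> k != l ->
  i != k -> i != l -> j != k -> j != l ->
  divdiff i j (divdiff k l f) = divdiff k l (divdiff i j f).
Proof.
move=> ij kl ik il jk jl; apply: divdiff_eq => //; apply: (mulfI (XB_neq0 kl)).
have [ki li kj lj] : [/\ k != i, l != i, k != j & l != j].
  by rewrite ![_ == i]eq_sym ![_ == j]eq_sym.
have st g : msym (tperm k l) (msym (tperm i j) g) = msym (tperm i j) (msym (tperm k l) g).
  by rewrite -!msymMm [(tperm k l * _)%g]conjgC tpermJ !tpermD.
have sa : msym (tperm k l) ('X_i - 'X_j) = 'X_i - 'X_j :> R.
  by rewrite msymB !msym_tpermX !tpermD.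
have rb : msym (tperm i j) ('X_k - 'X_l) = 'X_k - 'X_l :> R.
  by rewrite msymB !msym_tpermX !tpermD.
rewrite mulrCA divdiffP mulrBr -{2}sa -msymM divdiffP mulrBr divdiffP -{1}rb -msymM divdiffP.
by rewrite (msymB _ f) (msymB _ f) st sub_sub_exchange.
Qed.

Section Triple.
Variables (s r : 'S_n) (A B f X Y Z : R).
Hypotheses (sA : msym s A = - A) (sB : msym s B = A + B)
  (rA : msym r A = A + B) (sZ : msym s Z = Z)
  (EZ : A * Z = f - msym s f) (EY : B * Y = Z - msym r Z) (EX : A * X = Y - msym s Y).

(** The threefold divided difference is the alternating sum over the six
    permutations generated by s and r, divided by the Vandermonde product; this
    is symmetric in s and r. *)
Lemma triple_divdiff : A * B * (A + B) * X = f - msym s f - msym r f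
  + msym r (msym s f) + msym s (msym r f) - msym s (msym r (msym s f)).
Proof.
have E1 : (A + B) * msym s Y = Z - msym s (msym r Z).
  by have := congr1 (msym s) EY; rewrite msymM sB (msymB s Z) sZ.
have E2 : (A + B) * msym r Z = msym r f - msym r (msym s f).
  by have := congr1 (msym r) EZ; rewrite msymM rA (msymB r f).
have E3 : B * msym s (msym r Z) = msym s (msym r f) - msym s (msym r (msym s f)).
  have sAB : msym s (A + B) = B by rewrite msymD sA sB addKr.
  by have := congr1 (msym s) E2; rewrite msymM sAB (msymB s (msym r f)).
exact: triple_identity EZ EY EX E1 E2 E3.
Qed.
End Triple.

Lemma tperm_braid i j k : i != j -> j != k -> i != k ->
  (tperm i j * tperm j k * tperm i j = tperm j k * tperm i j * tperm j k :> 'S_n)%g.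
Proof.
move=> ij jk ik.
have -> : (tperm i j * tperm j k * tperm i j = tperm i k :> 'S_n)%g.
  have := tpermJ j k (tperm i j); rewrite tpermR tpermD // => <-.
  by rewrite /conjg tpermV mulgA.
have := tpermJ i j (tperm j k); rewrite tpermL tpermD 1?eq_sym // => <-.
by rewrite /conjg tpermV mulgA.
Qed.

Lemma divdiff_braid i j k f : i != j -> j != k -> i != k ->
  divdiff i j (divdiff j k (divdiff i j f)) = divdiff j k (divdiff i j (divdiff j k f)).
Proof.
move=> ij jk ik.
pose A : R := 'X_i - 'X_j; pose B : R := 'X_j - 'X_k.
have AB : A + B = 'X_i - 'X_k by rewrite /A /B addrA subrK.
have [ji kj ki] : [/\ j != i, k != j & k != i] by rewrite ![_ == i]eq_sym (eq_sym k).
have sA : msym (tperm i j) A = - A by rewrite msymB !msym_tpermX tpermL tpermR opprB.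
have rB : msym (tperm j k) B = - B by rewrite msymB !msym_tpermX tpermL tpermR opprB.
have sB : msym (tperm i j) B = A + B by rewrite AB msymB !msym_tpermX tpermR tpermD.
have rA : msym (tperm j k) A = A + B by rewrite AB msymB !msym_tpermX tpermL tpermD.
have H1 := triple_divdiff sA sB rA (msym_divdiff f ij) (divdiffP i j f)
  (divdiffP j k _) (divdiffP i j _).
rewrite addrC in sB rA.
have H2 := triple_divdiff rB rA sB (msym_divdiff f jk) (divdiffP j k f)
  (divdiffP i j _) (divdiffP j k _).
have nz : A * B * (A + B) != 0.
  by rewrite AB !mulf_neq0 ?XB_neq0.
apply: (mulfI nz); apply: (etrans H1).
rewrite [A * B]mulrC [A + B]addrC; apply/esym; apply: (etrans H2).
rewrite -!msymMm ?mulgA -(tperm_braid ij jk ik); exact: alternating_exchange.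
Qed.

End DivDiff.

(** * Independence of Schubert polynomials from the chosen ascents *)

Section Schubert.
Variable n : nat.
Notation R := {mpoly int[n]}.
Implicit Types (f g p : R) (i j l x y : 'I_n) (u v w : 'S_n).

Lemma plength_le w : (plength w <= 'C(n, 2))%N.
Proof.
have -> : 'C(n, 2) = #|[set p : 'I_n * 'I_n | (p.1 < p.2)%N]|.
  rewrite -bin2_sum big_mkord -sum1_card.
  rewrite (eq_bigl (fun p : 'I_n * 'I_n => true && (p.1 < p.2)%N)); last by move=> p;
    rewrite inE.
  rewrite -(pair_big_dep xpredT (fun a b : 'I_n => (a < b)%N) (fun _ _ => 1%N)) /=.
  rewrite (exchange_big_dep xpredT) //=; apply: eq_bigr => j _.
  rewrite -(big_ord_widen n (fun=> 1%N)) ?sum1_card ?card_ord //; exact: ltnW.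
by apply: subset_leq_card; apply/subsetP => p; rewrite !inE => /andP[].
Qed.

Definition ascent w i j := (i.+1 == j :> nat) && (w i < w j)%N.

Lemma ascent_cov w i j : ascent w i j -> cov w i j.
Proof. by case/andP=> /eqP ij wij; apply/covP; split=> // [|x]; lia. Qed.

Lemma ascent_neq w i j : ascent w i j -> i != j.
Proof. by case/andP=> /eqP ij _; rewrite -val_eqE /=; lia. Qed.

Lemma plength_ascent w i j : ascent w i j -> plength (swap w i j) = (plength w).+1.
Proof. by move/ascent_cov/plength_cov. Qed.

(** Each step adds an inversion, so a surplus of recursion depth is
    harmless. *)
Lemma schubert_rec_stable d d' w : ('C(n, 2) - plength w <= d)%N ->
  ('C(n, 2) - plength w <= d')%N -> schubert_rec d w = schubert_rec d' w.
Proof.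
have top i j v : ascent v i j -> (plength v < 'C(n, 2))%N.
  by move/plength_ascent => E; have := plength_le (swap v i j); rewrite E.
elim: d d' w => [|d IH] [|d'] w H H'; first exact: erefl.
- rewrite [schubert_rec d'.+1 w]/=; case: pickP => [[i j] /= /(top i j w) asc|_];
  last exact: erefl.
  by exfalso; lia.
- rewrite [schubert_rec d.+1 w]/=; case: pickP => [[i j] /= /(top i j w) asc|_];
  last exact: erefl.
  by exfalso; lia.
rewrite [schubert_rec d.+1 w]/= [schubert_rec d'.+1 w]/=.
case: pickP => [[i j] /= asc|_]; last exact: erefl.
congr divdiff; have := plength_ascent asc; rewrite /swap -/(permcomp w (tperm i j)) => E.
by apply: IH; rewrite E; lia.
Qed.

Lemma schubert_pick w : exists2 p : option ('I_n * 'I_n),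
  (if p is Some ij then ascent w ij.1 ij.2 else forall i j, ~~ ascent w i j) &
  schubert w = if p is Some ij then divdiff ij.1 ij.2 (schubert (swap w ij.1 ij.2))
               else staircase n.
Proof.
exists [pick p : 'I_n * 'I_n | ascent w p.1 p.2].
  by case: pickP => [p //|H] i j; rewrite (H (i, j)).
have E : forall d, ('C(n, 2) - plength w <= d)%N -> schubert w = schubert_rec d w.
  by move=> d; apply: schubert_rec_stable; apply: leq_subr.
rewrite (E 'C(n, 2).+1); last exact: leq_trans (leq_subr _ _) (leqnSn _).
rewrite [schubert_rec _ w]/=.
by case: pickP => [p asc|_]; exact: erefl.
Qed.

(** A confluence argument, by induction on the number of missing inversions: two
    ascents of w, adjacent or not, can be continued to a common permutation, and
    the corresponding composites of divided differences agree by the braid or by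
    the commutation relation. *)
Lemma schubert_divdiff w i j : ascent w i j ->
  schubert w = divdiff i j (schubert (swap w i j)).
Proof.
have [N] := ubnP ('C(n, 2) - plength w); elim: N w i j => // N IH w i j wN asc.
have lt_asc v a b : ascent v a b -> (plength v < 'C(n, 2))%N.
  by move/plength_ascent => E; have := plength_le (swap v a b); rewrite E.
have IH1 a b c d : ascent w a b -> ascent (swap w a b) c d ->
   schubert (swap w a b) = divdiff c d (schubert (swap (swap w a b) c d)).
  move=> ab cd; apply: IH cd; have := plength_ascent ab; have := lt_asc _ _ _ ab; lia.
have IH2 a b c d e (f : 'I_n) : ascent w a b -> ascent (swap w a b) c d ->
   ascent (swap (swap w a b) c d) e f ->
   schubert (swap (swap w a b) c d) = divdiff e f (schubert (swap (swap (swap w a b) c d) e f)).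
  move=> ab cd ef; apply: IH ef; have := plength_ascent ab; have := lt_asc _ _ _ ab.
  have := plength_ascent cd; lia.
(* By symmetry the ascents may be taken in increasing order. *)
have diamond a b c d : ascent w a b -> ascent w c d -> (a < c)%N ->
    divdiff c d (schubert (swap w c d)) = divdiff a b (schubert (swap w a b)).
  clear wN lt_asc IH => ab cd ac; have nab := ascent_neq ab; have ncd := ascent_neq cd.
  have [/eqP eab wab] := andP ab; have [/eqP ecd wcd] := andP cd.
  case: (eqVneq b c) => [bc|nbc].
    subst c; have nad : a != d by rewrite -val_eqE /=; move: eab ecd; clear; lia.
    have [nba ndb nda] : [/\ b != a, d != b & d != a] by rewrite ![_ == a]eq_sym (eq_sym d).
    have wad : (w a < w d)%N := ltn_trans wab wcd.
    have a1 : ascent (swap w b d) a b by rewrite /ascent eab eqxx swapL swapD.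
    have a2 : ascent (swap (swap w b d) a b) b d.
      have e1 : swap (swap w b d) a b b = w a by rewrite swapR swapD.
      have e2 : swap (swap w b d) a b d = w b by rewrite swapD // swapR.
      by rewrite /ascent ecd eqxx e1 e2.
    have b1 : ascent (swap w a b) b d by rewrite /ascent ecd eqxx swapR swapD.
    have b2 : ascent (swap (swap w a b) b d) a b.
      have e1 : swap (swap w a b) b d a = w b by rewrite swapD // swapL.
      have e2 : swap (swap w a b) b d b = w d by rewrite swapL swapD.
      by rewrite /ascent eab eqxx e1 e2.
    rewrite (IH1 _ _ _ _ cd a1) (IH2 _ _ _ _ _ _ cd a1 a2).
    rewrite (IH1 _ _ _ _ ab b1) (IH2 _ _ _ _ _ _ ab b1 b2).
    have -> : swap (swap (swap w a b) b d) a b = swap (swap (swap w b d) a b) b d.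
      by rewrite /swap !mulgA (tperm_braid nab ncd nad).
    exact: esym (divdiff_braid _ nab ncd nad).
  have [nbd nad nac] : [/\ b != d, a != d & a != c].
    by move: nbc ac ecd eab; clear; rewrite -!val_eqE /= => *; split; lia.
  have [nca nda ncb ndb] : [/\ c != a, d != a, c != b & d != b].
    by rewrite ![_ == a]eq_sym ![_ == b]eq_sym.
  have a1 : ascent (swap w c d) a b by rewrite /ascent eab eqxx !swapD.
  have b1 : ascent (swap w a b) c d by rewrite /ascent ecd eqxx !swapD.
  rewrite (IH1 _ _ _ _ cd a1) (IH1 _ _ _ _ ab b1).
  have -> : swap (swap w a b) c d = swap (swap w c d) a b.
    by rewrite /swap !mulgA [(tperm c d * tperm a b)%g]conjgC tpermJ !tpermD.
  exact: divdiff_commute.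
have [[[k l]|] /= Hp ->] := schubert_pick w; last by have := Hp i j; rewrite asc.
case: (ltngtP i k) => [ik|ki|/val_inj ik]; first exact: diamond.
  by apply/esym/diamond.
suff -> : j = l by rewrite ik.
by apply: val_inj; move: asc Hp; rewrite ik => /andP[/eqP/= <- _] /andP[/eqP].
Qed.

End Schubert.

(** * The ideal of symmetric polynomials without constant term *)

Section Ideal.
Variables (K : comNzRingType) (n : nat) (e : 'I_n -> K).

Definition in_ideal (p : K) := exists c : 'I_n -> K, p = \sum_(i < n) c i * e i.

Lemma in_ideal0 : in_ideal 0.
Proof. by exists (fun=> 0); rewrite big1 // => i _; rewrite mul0r. Qed.

Lemma in_idealD p r : in_ideal p -> in_ideal r -> in_ideal (p + r).
Proof.
move=> [c ->] [d ->]; exists (fun i => c i + d i).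
by rewrite -big_split; apply: eq_bigr => i _; rewrite mulrDl.
Qed.

Lemma in_idealM a p : in_ideal p -> in_ideal (a * p).
Proof.
move=> [c ->]; exists (fun i => a * c i).
by rewrite mulr_sumr; apply: eq_bigr => i _; rewrite mulrA.
Qed.

Lemma in_idealN p : in_ideal p -> in_ideal (- p).
Proof. by rewrite -mulN1r; apply: in_idealM. Qed.

Lemma in_ideal_sum (I : finType) (P : pred I) (F : I -> K) :
  (forall i, P i -> in_ideal (F i)) -> in_ideal (\sum_(i | P i) F i).
Proof. by move=> H; apply: (big_ind in_ideal) => //; [exact: in_ideal0|exact: in_idealD]. Qed.

Lemma in_ideal_gen i : in_ideal (e i).
Proof.
exists (fun j => (j == i)%:R); rewrite (bigD1 i) //= eqxx mul1r big1 ?addr0 // => j /negPf->.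
by rewrite mul0r.
Qed.
End Ideal.

Section Congruence.
Variables (K : comNzRingType) (n : nat) (e : 'I_n -> K).

Definition congr_mod (p r : K) := in_ideal e (p - r).

Lemma congr_mod_refl p : congr_mod p p.
Proof. by rewrite /congr_mod subrr; apply: in_ideal0. Qed.

Lemma congr_mod_sym p r : congr_mod p r -> congr_mod r p.
Proof. by move=> h; rewrite /congr_mod -opprB; apply: in_idealN. Qed.

Lemma congr_mod_trans r p s : congr_mod p r -> congr_mod r s -> congr_mod p s.
Proof. by move=> h1 h2; have := in_idealD h1 h2; rewrite addrA subrK. Qed.

Lemma congr_modD p r p' r' : congr_mod p r -> congr_mod p' r' -> congr_mod (p + p') (r + r').
Proof. by move=> h1 h2; have := in_idealD h1 h2; rewrite addrACA -opprD. Qed.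

Lemma congr_modN p r : congr_mod p r -> congr_mod (- p) (- r).
Proof. by move=> h; rewrite /congr_mod -opprD; apply: in_idealN. Qed.

Lemma congr_modM a p r : congr_mod p r -> congr_mod (a * p) (a * r).
Proof. by move=> h; rewrite /congr_mod -mulrBr; apply: in_idealM. Qed.

Lemma congr_mod_sum (I : finType) (F G : I -> K) :
  (forall i, congr_mod (F i) (G i)) -> congr_mod (\sum_i F i) (\sum_i G i).
Proof. by move=> h; rewrite /congr_mod -sumrB; apply: in_ideal_sum => i _; apply: h. Qed.
End Congruence.

(** Here J is an arbitrary ideal; it will be the colon ideal of the ideal of
    symmetric polynomials by a monomial. *)
Section CoefIdeal.
Variables (K : comNzRingType) (J : K -> Prop).
Hypotheses (J0 : J 0) (JD : forall p r, J p -> J r -> J (p + r)) (JM : forall a p, J p ->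
  J (a * p)).

Definition coefs_in (P : {poly K}) := forall k, J P`_k.

Lemma coefs_inD P Q : coefs_in P -> coefs_in Q -> coefs_in (P + Q).
Proof. by move=> hP hQ k; rewrite coefD; apply: JD. Qed.

Lemma coefs_inM P Q : coefs_in Q -> coefs_in (P * Q).
Proof. by move=> hQ k; rewrite coefM; apply: (big_ind J) => // i _; apply: JM. Qed.

Lemma coefs_inMr P Q : coefs_in Q -> coefs_in (Q * P).
Proof. by rewrite mulrC; apply: coefs_inM. Qed.

Lemma coefs_in_horner P x : coefs_in P -> J P.[x].
Proof. by move=> hP; rewrite horner_coef; apply: (big_ind J) => // i _; rewrite mulrC;
  apply: JM. Qed.

Lemma coefs_inC c : J c -> coefs_in c%:P.
Proof. by move=> hc k; rewrite coefC; case: ifP. Qed.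

Lemma coefs_in_prod (I : finType) (A : pred I) (b : I -> K) :
  (forall i, A i -> J (b i)) ->
  coefs_in (\prod_(i | A i) ('X - (b i)%:P) - \prod_(i | A i) 'X).
Proof.
move=> Jb; apply: (big_rec2 (fun P Q => coefs_in (P - Q))).
  by rewrite subrr => k; rewrite coef0.
move=> i Q P Ai hPQ.
have -> : ('X - (b i)%:P) * Q - 'X * P = 'X * (Q - P) + (- Q) * (b i)%:P by ring.
apply: coefs_inD; first exact: coefs_inM.
by apply: coefs_inM; apply: coefs_inC; apply: Jb.
Qed.

Lemma coefs_in_rootX P x m : coefs_in (P - 'X^m) -> P.[x] = 0 -> J (x ^+ m).
Proof.
move=> /(coefs_in_horner x) h P0; have := JM (-1) h.
by rewrite hornerD hornerN hornerXn P0 sub0r mulN1r opprK.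
Qed.

Lemma horner_prod_root (I : finType) (A : pred I) (b : I -> K) x :
  A x -> (\prod_(i | A i) ('X - (b i)%:P)).[b x] = 0.
Proof. by move=> Ax; rewrite horner_prod (bigD1 x) //= hornerXsubC subrr mul0r. Qed.

End CoefIdeal.

Section Monk.
Variable n : nat.
Notation R := {mpoly int[n]}.
Implicit Types (f g p : R) (i j l x y : 'I_n) (u v w : 'S_n).

Notation inI := (@in_ideal R n (fun i : 'I_n => mesym n int i.+1)).

(** Divided differences are linear over symmetric polynomials. *)
Lemma divdiff_in_ideal i j p : i != j -> inI p -> inI (divdiff i j p).
Proof.
move=> ij [c ->]; rewrite divdiff_sum //; apply: in_ideal_sum => k _.
have se : msym (tperm i j) (mesym n int k.+1) = mesym n int k.+1.
  by have /issymP := mesym_sym n int k.+1; apply.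
rewrite divdiffM // (divdiff_fixed ij se) mulr0 addr0.
exact/in_idealM/in_ideal_gen.
Qed.

(** The part of the staircase monomial in the first x variables. *)
Definition partial_staircase (x : nat) : R := \prod_(i < n | (i < x)%N) 'X_i ^+ (n.-1 - i).

Lemma partial_staircase_dvd (x : nat) y : (y < x)%N ->
  exists c, partial_staircase x = c * (partial_staircase y * 'X_y ^+ (n.-1 - y)).
Proof.
move=> yx; exists (\prod_(i < n | (y < i < x)%N) 'X_i ^+ (n.-1 - i)).
rewrite /partial_staircase (bigID (fun i : 'I_n => (y < i)%N)) /=; congr (_ * _).
  by apply: eq_bigl => i; rewrite andbC.
rewrite (bigD1 y) /= ?yx ?ltnn // mulrC; congr (_ * _).
by apply: eq_bigl => i; rewrite -val_eqE /=; lia.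
Qed.

(** Let J be the colon ideal of the ideal by partial_staircase x.  By induction
    J contains the variables before x.  Modulo the ideal the product of all
    'X - ('X_i)%:P is 'X^n, by Viete, so modulo J the product over i >= x is
    'X^(n - x).  Evaluation at 'X_x gives the claim. *)
Lemma X_partial_staircase x : inI (partial_staircase x * 'X_x ^+ (n - x)).
Proof.
have [N] := ubnP (x : nat); elim: N x => // N IH x xN.
pose J p := inI (partial_staircase x * p).
have J0 : J 0 by rewrite /J mulr0; exact: in_ideal0.
have JD p r : J p -> J r -> J (p + r) by rewrite /J mulrDr; exact: in_idealD.
have JM a p : J p -> J (a * p) by rewrite /J mulrCA; exact: in_idealM.
have JI p : inI p -> J p by apply: in_idealM.
have Jy y : (y < x)%N -> J 'X_y.
  move=> yx; rewrite /J; have [c ->] := partial_staircase_dvd yx; rewrite -!mulrA -exprSr.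
  apply: in_idealM; have -> : (n.-1 - y).+1 = (n - y)%N by have := ltn_ord y; lia.
  by apply: IH; lia.
pose A (i : 'I_n) := (i < x)%N.
pose P : {poly R} := \prod_(i < n) ('X - ('X_i)%:P).
pose Q : {poly R} := \prod_(i < n | ~~ A i) ('X - ('X_i)%:P).
have hP : coefs_in J (P - 'X^n).
  rewrite /P Viete big_ord_recl /= expr0 mesym0E !scale1r subn0 addrC addKr => k.
  rewrite coef_sum; apply: (big_ind J) => // i _; rewrite !coefZ; apply: (JM).
  rewrite mulrC; apply: (JM); apply: JI.
  exact: (in_ideal_gen (fun i : 'I_n => mesym n int i.+1)).
have cA : #|A| = x.
  rewrite -sum1_card -(big_ord_widen n (fun=> 1%N)) ?sum1_card ?card_ord //; exact: ltnW.
have hPQ : coefs_in J (P - 'X^x * Q).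
  rewrite /P (bigID A) /= -/Q -mulrBl; apply: coefs_inMr => //.
  have := coefs_in_prod J0 JD JM Jy; rewrite -/A prodr_const cA.
  exact.
(* Both sides are multiplied by 'X^x, which shifts the coefficients by x. *)
have hQ : coefs_in J (Q - 'X^(n - x)).
  move=> k; have := hP (k + x)%N; have := hPQ (k + x)%N.
  rewrite !coefB coefXnM addnK ltnNge leq_addl /= !coefXn.
  have -> : (k + x == n)%N = (k == n - x)%N by have := ltn_ord x; lia.
  move=> h1 h2; have := JD _ _ h2 (JM (-1) _ h1).
  by rewrite mulN1r opprB addrC addrA subrK.
apply: (coefs_in_rootX J0 JD JM hQ).
by apply: horner_prod_root; rewrite /A ltnn.
Qed.

(** Monk's rule for the longest permutation, which has no covers above it. *)
Lemma X_staircase x : inI ('X_x * staircase n).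
Proof.
rewrite /staircase; have -> : \prod_(i < n) 'X_i ^+ (n.-1 - i) = partial_staircase n :> R.
  by apply: eq_bigl => i; rewrite ltn_ord.
have [c ->] := partial_staircase_dvd (ltn_ord x).
rewrite mulrCA; apply: in_idealM; rewrite mulrCA -exprS.
have -> : (n.-1 - x).+1 = (n - x)%N by have := ltn_ord x; lia.
exact: X_partial_staircase.
Qed.

End Monk.

(** * Monk's rule modulo the ideal *)

Local Opaque schubert.


Section MonkRule.
Variable n : nat.
Notation R := {mpoly int[n]}.
Implicit Types (i j l x y : 'I_n) (u v w : 'S_n).
Notation inI := (@in_ideal R n (fun i : 'I_n => mesym n int i.+1)).

Definition covterm w i j : R := if cov w i j then schubert (swap w i j) else 0.
Definition monk x w : R := \sum_l (covterm w x l - covterm w l x).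

Lemma no_ascent_decreasing w : (forall i j, ~~ ascent w i j) ->
  forall i j, (i < j)%N -> (w j < w i)%N.
Proof.
move=> H i j; have [N] := ubnP (j - i); elim: N j => // N IH j jiN ij.
have lt1 (a b : 'I_n) : a.+1 = b :> nat -> (w b < w a)%N.
  move=> ab; have := H a b; rewrite /ascent ab eqxx /= -leqNgt leq_eqVlt => /orP[|//].
  by rewrite val_eqE (inj_eq perm_inj) -val_eqE /=; lia.
case: (eqVneq i.+1 j) => [/lt1 //|nij].
have jn := ltn_ord j; have j1 : (j.-1 < n)%N by lia.
have := IH (Ordinal j1); have := lt1 (Ordinal j1) j; rewrite /=; lia.
Qed.

Lemma schubert_ascent_divdiff w i j : ascent w i j -> divdiff i j (schubert w) = 0.
Proof.
by move=> asc; rewrite (schubert_divdiff asc); apply/divdiff_divdiff/(ascent_neq asc).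
Qed.

(** The lifting property: a cover of w other than the exchange at the ascent
    keeps this ascent. *)
Lemma cov_ascent w i j x y : ascent w i j -> cov w x y -> (x, y) != (i, j) ->
  ascent (swap w x y) i j.
Proof.
case/andP=> ij wij /covP[xy wxy H] ne; rewrite /ascent ij /=; move/eqP: ij => ij.
have Hi := H i; have Hj := H j.
have {}ne : (x != i :> nat) || (y != j :> nat).
  by move: ne; rewrite xpair_eqE negb_and.
have sE a : swap w x y a = if a == x :> nat then w y else if a == y :> nat then w x else w a.
  rewrite !val_eqE swapE; case: tpermP => [->|->|/eqP/negPf-> /eqP/negPf->] //;
    rewrite eqxx //; case: eqP => // ->; done.
have dix : i != x :> nat -> w i != w x :> nat by rewrite val_eqE => ?;
  rewrite val_eqE (inj_eq perm_inj).
have djx : j != x :> nat -> w j != w x :> nat by rewrite val_eqE => ?;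
  rewrite val_eqE (inj_eq perm_inj).
have diy : i != y :> nat -> w i != w y :> nat by rewrite val_eqE => ?;
  rewrite val_eqE (inj_eq perm_inj).
have djy : j != y :> nat -> w j != w y :> nat by rewrite val_eqE => ?;
  rewrite val_eqE (inj_eq perm_inj).
rewrite !sE; clear H sE.
case: (eqVneq (i : nat) x) => [/val_inj ?|?]; case: (eqVneq (j : nat) x) => [/val_inj ?|?];
case: (eqVneq (i : nat) y) => [/val_inj ?|?]; case: (eqVneq (j : nat) y) => [/val_inj ?|?];
subst; lia.
Qed.

Section Step.
Variables (w : 'S_n) (i j : 'I_n).
Hypothesis asc : ascent w i j.
Let s := tperm i j.
Let w' := swap w i j.

Lemma swap_conj x y : swap w' (s x) (s y) = swap (swap w x y) i j.
Proof.
rewrite /w' /swap -/s -tpermJ /conjg tpermV -!mulgA.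
by rewrite (mulgA s s) tperm2 mul1g.
Qed.

Lemma swap_lt x y : (x, y) != (i, j) -> (x < y)%N -> (s x < s y)%N.
Proof.
have [/eqP ij _] := andP asc; rewrite xpair_eqE negb_and -!val_eqE /= => ne xy.
have sE a : s a = if a == i :> nat then j else if a == j :> nat then i else a.
  rewrite !val_eqE /s; case: tpermP => [->|->|/eqP/negPf-> /eqP/negPf->] //;
    rewrite eqxx //; case: eqP => // ->; done.
rewrite !sE; clear asc w'; repeat case: ifP; lia.
Qed.

(** Conjugation by s matches the covers of w with those covers of w' that have a
    descent at i; the other covers of w' are killed by the divided
    difference. *)
Lemma divdiff_covterm x y : (x, y) != (i, j) ->
  divdiff i j (covterm w' (s x) (s y)) = covterm w x y.
Proof.
move=> ne; have nij := ascent_neq asc; have ij : i.+1 = j by have [/eqP] := andP asc.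
have lw' : plength w' = (plength w).+1 := plength_ascent asc.
rewrite /covterm swap_conj; case: ifP => cv'; last first.
  rewrite divdiff0 //; case: ifP => // cv; have a1 := cov_ascent asc cv ne.
  move: cv'; rewrite -cov_plength ?swap_lt ?(cov_lt cv) // swap_conj.
  by rewrite (plength_ascent a1) (plength_cov cv) lw' eqxx.
have lV := plength_cov cv'; rewrite swap_conj in lV.
case: (ltnP (swap w x y i) (swap w x y j)) => vij.
  have a1 : ascent (swap w x y) i j by rewrite /ascent ij eqxx.
  have -> : cov w x y.
    have ne' : (s x, s y) != (i, j).
      apply: contraTneq cv' => -[-> ->]; apply/negP => /cov_ltu.
      by have [_ wij] := andP asc; rewrite /w' swapL swapR ltnNge (ltnW wij).
    have xy : (x < y)%N by rewrite -(tpermK i j x) -(tpermK i j y) swap_lt // (cov_lt cv').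
    by rewrite -cov_plength //; move: lV; rewrite (plength_ascent a1) lw' => -[->].
  by rewrite -(schubert_divdiff a1).
have a2 : ascent (swap (swap w x y) i j) i j.
  rewrite /ascent ij eqxx swapL swapR ltn_neqAle vij andbT.
  by rewrite val_eqE (inj_eq perm_inj) eq_sym.
rewrite (schubert_ascent_divdiff a2); case: ifP => // cv.
by have [_] := andP (cov_ascent asc cv ne); rewrite ltnNge vij.
Qed.

Lemma divdiff_covterm_ij : divdiff i j (covterm w' (s i) (s j)) = 0.
Proof.
by rewrite /covterm /s tpermL tpermR /cov; have [/eqP ij _] := andP asc;
   rewrite ltnNge -ij leqnSn divdiff0 // (ascent_neq asc).
Qed.

(** The correction is the cover from w to w', which has no counterpart above
    w'. *)
Lemma divdiff_monk x : divdiff i j (monk (s x) w') =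
  monk x w + ((x == j)%:R - (x == i)%:R) * schubert w'.
Proof.
have nij := ascent_neq asc.
have cij : covterm w i j = schubert w' by rewrite /covterm (ascent_cov asc).
have cji : covterm w j i = 0.
  by rewrite /covterm /cov; have [/eqP ij _] := andP asc; rewrite ltnNge -ij leqnSn.
rewrite /monk (reindex_inj (@perm_inj _ s)) divdiff_sum //=.
have E a l : (a, l) != (i, j) -> (l, a) != (i, j) ->
   divdiff i j (covterm w' (s a) (s l) - covterm w' (s l) (s a)) =
     covterm w a l - covterm w l a.
  by move=> n1 n2; rewrite divdiffD // divdiffN // !divdiff_covterm.
have [nji nji'] : j != i /\ (j == i) = false by rewrite eq_sym (negPf nij).
case: (eqVneq x i) => [e|xi].
  rewrite e (negPf nij) (bigD1 j) //= [in RHS](bigD1 j) //=.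
  rewrite divdiffD // divdiffN // divdiff_covterm_ij divdiff_covterm; last first.
    by rewrite xpair_eqE nji'.
  rewrite cij cji !subr0 sub0r mulN1r addrAC subrr !add0r.
  by apply: eq_bigr => l lj; apply: (E i l); rewrite xpair_eqE ?(negPf lj) ?(negPf nij) ?andbF.
case: (eqVneq x j) => [e|xj].
  rewrite e (bigD1 i) //= [in RHS](bigD1 i) //=.
  rewrite divdiffD // divdiffN // divdiff_covterm_ij divdiff_covterm; last first.
    by rewrite xpair_eqE nji'.
  rewrite cij cji !subr0 sub0r mul1r addrAC addNr !add0r.
  by apply: eq_bigr => l li; apply: (E j l); rewrite xpair_eqE ?(negPf li) ?nji' ?andbF.
rewrite subrr mul0r addr0; apply: eq_bigr => l _; apply: (E x l).
  by rewrite xpair_eqE (negPf xi).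
by rewrite xpair_eqE (negPf xj) andbF.
Qed.

(** Apply the divided difference to Monk's rule at w'.  By the Leibniz formula
    the extra term of divdiff_monk is the divided difference of the
    variable. *)
Lemma monk_step x :
  inI ('X_(s x) * schubert w' - monk (s x) w') -> inI ('X_x * schubert w - monk x w).
Proof.
have nij := ascent_neq asc.
suff -> : 'X_x * schubert w - monk x w = divdiff i j ('X_(s x) * schubert w' - monk (s x) w').
  exact: divdiff_in_ideal.
rewrite divdiffD // divdiffN // divdiff_monk divdiffM // -(schubert_divdiff asc).
rewrite msym_tpermX tpermK.
have -> : divdiff i j 'X_(s x) = (x == j)%:R - (x == i)%:R :> R.
  rewrite /s; case: tpermP => [->|->|/eqP xi /eqP xj].
  - by rewrite divdiffXr // eqxx (negPf nij) sub0r.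
  - by rewrite divdiffXl // eqxx eq_sym (negPf nij) subr0.
  - by rewrite divdiffX // (negPf xi) (negPf xj) subrr.
by rewrite [X in _ = X]addrC opprD -addrA [- (_ * _) + _]addrA addNr add0r addrC.
Qed.
End Step.

(** Descending induction on the length, from the longest permutation. *)
Lemma monk_rule w x : inI ('X_x * schubert w - monk x w).
Proof.
have [N] := ubnP ('C(n, 2) - plength w); elim: N w x => // N IH w x wN.
have [[[i j]|] /= Hp Ew] := schubert_pick w.
  apply: (monk_step Hp); apply: IH.
  have := plength_ascent Hp; have := plength_le (swap w i j); move: wN; clear; lia.
have dec := no_ascent_decreasing Hp.
have cov0 i j : cov w i j = false.
  by apply/negP => /covP[ij wij _]; have := dec _ _ ij; rewrite ltnNge ltnW.
have -> : monk x w = 0.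
  by rewrite /monk big1 // => l _; rewrite /covterm !cov0 subrr.
by rewrite subr0 Ew; exact: X_staircase.
Qed.
End MonkRule.

(** * Hook Schur polynomials *)

Section HookWords.
Variable n : nat.
Notation R := {mpoly int[n]}.

(** The entries of a hook tableau read from the bottom of the first column up to
    the corner, at index a, and then along the first row. *)
Definition hword M (a k : nat) (y : {ffun 'I_M.+1 -> 'I_n}) : bool :=
  [forall i, (y i < k)%N] &&
  [forall i : 'I_M.+1, forall j : 'I_M.+1, (i < j)%N ==>
     ((j <= a)%N ==> (y j < y i)%N) && ((a <= i)%N ==> (y i <= y j)%N)].

Lemma hwordP M a k (y : {ffun 'I_M.+1 -> 'I_n}) : reflect
  [/\ forall i, (y i < k)%N,
      forall i j : 'I_M.+1, (i < j)%N -> (j <= a)%N -> (y j < y i)%N &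
      forall i j : 'I_M.+1, (i < j)%N -> (a <= i)%N -> (y i <= y j)%N]
  (hword a k y).
Proof.
apply: (iffP andP) => [[/forallP H1 /forallP H2]|[H1 H2 H3]].
  have H i j := forallP (H2 i) j.
  split=> // i j ij; first by move=> ja; have := H i j; rewrite ij ja => /andP[].
  by move=> ai; have := H i j; rewrite ij ai => /andP[].
split; apply/forallP => // i; apply/forallP => j; apply/implyP => ij.
by apply/andP; split; apply/implyP; [exact: H2|exact: H3].
Qed.

Definition hookpoly M (a k : nat) : R :=
  \sum_(y : {ffun 'I_M.+1 -> 'I_n} | hword a k y) \prod_i 'X_(y i).

Lemma hookpoly00 (x : 'I_n) : hookpoly 0 0 x.+1 = hookpoly 0 0 x + 'X_x.
Proof.
have hE k (y : {ffun 'I_1 -> 'I_n}) : hword 0 k y = (y ord0 < k)%N.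
  apply/hwordP/idP => [[//]|yk]; split=> [i|i j|i j]; rewrite !ord1 //.
rewrite /hookpoly (bigID (fun y : {ffun 'I_1 -> 'I_n} => y ord0 == x)) /= addrC; congr (_ + _).
  by apply: eq_bigl => y; rewrite !hE -val_eqE /= ltnS; lia.
rewrite (big_pred1 [ffun=> x]); first by rewrite big_ord1 ffunE.
move=> y; rewrite hE /=; apply/andP/eqP => [[_ /eqP yx]|->]; last by rewrite ffunE.
by apply/ffunP => i; rewrite ord1 ffunE.
Qed.

Definition insert_letter M (h : 'I_M.+1) (c : 'I_n) (z : {ffun 'I_M -> 'I_n}) :=
  [ffun i => if unlift h i is Some j then z j else c].

Lemma insert_letter_at M (h : 'I_M.+1) c z : insert_letter h c z h = c.
Proof. by rewrite ffunE unlift_none. Qed.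

Lemma insert_letter_lift M (h : 'I_M.+1) c z j : insert_letter h c z (lift h j) = z j.
Proof. by rewrite ffunE liftK. Qed.

Lemma sum_insert_letter M (h : 'I_M.+1) (c : 'I_n) (P : pred {ffun 'I_M.+1 -> 'I_n}) :
  \sum_(y | P y && (y h == c)) \prod_i 'X_(y i) =
  'X_c * \sum_(z | P (insert_letter h c z)) \prod_i 'X_(z i) :> R.
Proof.
rewrite (reindex_onto (insert_letter h c) (fun y => [ffun j => y (lift h j)])) /=; last first.
  move=> y /andP[_ /eqP yh]; apply/ffunP => i; rewrite ffunE.
  by case: unliftP => [j ->|->]; rewrite ?ffunE.
rewrite mulr_sumr; apply: eq_big => [z|z _].
  rewrite insert_letter_at eqxx andbT; have -> : [ffun j => insert_letter h c z (lift h j)] = z.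
    by apply/ffunP => j; rewrite ffunE insert_letter_lift.
  by rewrite eqxx andbT.
rewrite (bigD1_ord h) //= insert_letter_at; congr (_ * _).
by apply: eq_bigr => i _; rewrite insert_letter_lift.
Qed.

Lemma hword_last M a (x : 'I_n) (z : {ffun 'I_M.+1 -> 'I_n}) : (a <= M)%N ->
  hword a x.+1 (insert_letter ord_max x z) = hword a x.+1 z.
Proof.
move=> aM; apply/hwordP/hwordP => [[H1 H2 H3]|[H1 H2 H3]]; split.
- by move=> i; have := H1 (lift ord_max i); rewrite insert_letter_lift.
- by move=> i j ij ja; have := H2 (lift ord_max i) (lift ord_max j);
    rewrite !insert_letter_lift !lift_max; apply.
- by move=> i j ij ja; have := H3 (lift ord_max i) (lift ord_max j);
    rewrite !insert_letter_lift !lift_max; apply.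
- by move=> i; case: (unliftP ord_max i) => [i' ->|->];
  rewrite ?insert_letter_lift ?insert_letter_at.
- move=> i j; case: (unliftP ord_max i) => [i' ->|->]; case: (unliftP ord_max j) => [j' ->|->];
    rewrite ?insert_letter_lift ?insert_letter_at ?lift_max /=; try lia.
  exact: H2.
- move=> i j; case: (unliftP ord_max i) => [i' ->|->]; case: (unliftP ord_max j) => [j' ->|->];
    rewrite ?insert_letter_lift ?insert_letter_at ?lift_max /=; try lia.
  + exact: H3.
  + by move=> _ _; have := H1 i'.
  + by move=> H; have := leq_trans H (ltnW (ltn_ord j')); rewrite ltnn.
Qed.

Lemma hword_first M a (x : 'I_n) (z : {ffun 'I_M.+1 -> 'I_n}) : (a <= M)%N ->
  let y := insert_letter ord0 x z in
  hword a.+1 x.+1 y && ~~ ((a < M)%N && (y ord_max == x)) = hword a x z.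
Proof.
move=> aM y; have y0 : y ord0 = x by rewrite /y insert_letter_at.
have yl j : y (lift ord0 j) = z j by rewrite /y insert_letter_lift.
have -> : y ord_max = z ord_max.
  by rewrite -yl; congr (y _); apply: val_inj; rewrite /= /bump.
apply/andP/hwordP => [[/hwordP[H1 H2 H3] nm]|[H1 H2 H3]]; split.
- move=> i; case: (ltnP a i) => ai; last first.
    by have := H2 ord0 (lift ord0 i); rewrite y0 yl lift0 => -> //; lia.
  have aM' : (a < M)%N by have := ltn_ord i; lia.
  have zm : (z ord_max < x)%N.
    move: nm; rewrite aM' /= => zm; have := H1 (lift ord0 ord_max); rewrite yl ltnS leq_eqVlt.
    by rewrite val_eqE (negPf zm).
  case: (eqVneq i ord_max) => [->//|im].
  have im' : (i < M)%N by move: im; rewrite -val_eqE /=; have := ltn_ord i; lia.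
  by have := H3 (lift ord0 i) (lift ord0 ord_max); rewrite !yl !lift0 /= => H;
    apply: leq_ltn_trans (H _ _) zm; lia.
- by move=> i j ij ja; have := H2 (lift ord0 i) (lift ord0 j); rewrite !yl !lift0; apply; lia.
- by move=> i j ij ja; have := H3 (lift ord0 i) (lift ord0 j); rewrite !yl !lift0; apply; lia.
- apply/hwordP; split.
  + move=> i; case: (unliftP ord0 i) => [i' ->|->]; rewrite ?yl ?y0 // ltnS ltnW //.
  + move=> i j; case: (unliftP ord0 i) => [i' ->|->]; case: (unliftP ord0 j) => [j' ->|->];
      rewrite ?yl ?y0 ?lift0 //=.
    by rewrite !ltnS; apply: H2.
  + move=> i j; case: (unliftP ord0 i) => [i' ->|->]; case: (unliftP ord0 j) => [j' ->|->];
      rewrite ?yl ?y0 ?lift0 //=.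
    by rewrite !ltnS; apply: H3.
- by rewrite negb_and -val_eqE /=; have := H1 ord_max; lia.
Qed.

Lemma hword_rest M a (x : 'I_n) (y : {ffun 'I_M.+2 -> 'I_n}) : (a <= M.+1)%N ->
  [&& hword a x.+1 y, ~~ ((a <= M)%N && (y ord_max == x)) & ~~ ((0 < a)%N && (y ord0 == x))]
  = hword a x y.
Proof.
move=> aM; apply/and3P/hwordP => [[/hwordP[H1 H2 H3] nm n0]|[H1 H2 H3]]; last first.
  split.
  - by apply/hwordP; split=> // i; rewrite ltnS ltnW.
  - by rewrite negb_and -val_eqE /=; have := H1 ord_max; lia.
  - by rewrite negb_and -val_eqE /=; have := H1 ord0; lia.
split=> // i; case: (ltnP i a) => ia.
  have y0 : (y ord0 < x)%N.
    have := H1 ord0; rewrite ltnS leq_eqVlt val_eqE.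
    by move: n0; rewrite (leq_ltn_trans (leq0n i) ia) /= => /negPf ->.
  case: (eqVneq i ord0) => [->//|i0]; apply: ltn_trans y0; apply: H2; last exact: ltnW.
  by rewrite lt0n.
case: (ltnP M a) => Ma.
  have -> : i = ord_max by apply: val_inj => /=; have := ltn_ord i; lia.
  have a0 : (0 < a)%N by lia.
  have y0 : (y ord0 < x)%N.
    have := H1 ord0; rewrite ltnS leq_eqVlt val_eqE.
    by move: n0; rewrite a0 /= => /negPf ->.
  by apply: ltn_trans y0; apply: H2.
have ym : (y ord_max < x)%N.
  have := H1 ord_max; rewrite ltnS leq_eqVlt val_eqE.
  by move: nm; rewrite Ma /= => /negPf ->.
case: (eqVneq i ord_max) => [->//|im]; apply: leq_ltn_trans ym; apply: H3 => //.
by move: im; rewrite -val_eqE /=; have := ltn_ord i; lia.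
Qed.

(** The largest letter x can occur at the end of the row, where it is removed
    first, and otherwise at the bottom of the column, where it occurs once. *)
Lemma hookpolyS M a (x : 'I_n) : (a <= M.+1)%N ->
  hookpoly M.+1 a x.+1 = hookpoly M.+1 a x
    + (if (a <= M)%N then 'X_x * hookpoly M a x.+1 else 0)
    + (if a is a'.+1 then 'X_x * hookpoly M a' x else 0).
Proof.
move=> aM.
rewrite {1}/hookpoly (bigID (fun y : {ffun 'I_M.+2 ->
  'I_n} => (a <= M)%N && (y ord_max == x))) /=.
rewrite [X in _ + X](bigID (fun y : {ffun 'I_M.+2 -> 'I_n} => (0 < a)%N && (y ord0 == x))) /=.
rewrite [RHS]addrAC [in RHS]addrC; congr (_ + _).
  case: ifP => aM'; last by rewrite big_pred0 // => y; rewrite andbF.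
  rewrite sum_insert_letter; congr (_ * _); apply: eq_bigl => z; exact: hword_last.
rewrite [RHS]addrC; congr (_ + _); last first.
  by apply: eq_bigl => y; rewrite -andbA hword_rest.
case: a aM => [|a] aM; first by rewrite big_pred0 // => y; rewrite andbF.
rewrite sum_insert_letter; congr (_ * _); apply: eq_bigl => z.
by rewrite -[RHS]hword_first.
Qed.
End HookWords.

Section HookTableaux.
Variables (n k a b : nat).
Notation R := {mpoly int[n]}.
Let lam := hook a.+1 b.+1.

Lemma size_hook : size lam = a.+1. Proof. by rewrite /= size_nseq. Qed.

Lemma nth_hook r : nth 0%N lam r = if r is r'.+1 then (r' < a)%N : nat else b.+1.
Proof. by case: r => //= r; rewrite nth_nseq; case: ifP. Qed.

Fact cell_row_subproof (i : 'I_(a + b).+1) : (a - i < size lam)%N.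
Proof. by rewrite size_hook; lia. Qed.
Fact cell_col_subproof (i : 'I_(a + b).+1) : (i - a < head 0%N lam)%N.
Proof. by rewrite /=; have := ltn_ord i; lia. Qed.
Fact cell_subproof (i : 'I_(a + b).+1) : (i - a < nth 0%N lam (a - i))%N.
Proof.
rewrite nth_hook; have := ltn_ord i; case E: (a - i)%N => [|r]; first by lia.
by rewrite (_ : (r < a)%N = true); lia.
Qed.

(** Truncated subtraction puts an index before the corner into column 0 and one
    after it into row 0. *)
Definition hook_cell (i : 'I_(a + b).+1) : cell lam :=
  exist (fun c : 'I_(size lam) * 'I_(head 0%N lam) => (c.2 < nth 0%N lam c.1)%N)
    (Ordinal (cell_row_subproof i), Ordinal (cell_col_subproof i)) (cell_subproof i).

Definition hook_index (c : cell lam) : 'I_(a + b).+1 := inord (a - (val c).1 + (val c).2).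

Lemma hook_cell_row i : (val (hook_cell i)).1 = (a - i)%N :> nat. Proof. by []. Qed.
Lemma hook_cell_col i : (val (hook_cell i)).2 = (i - a)%N :> nat. Proof. by []. Qed.

Lemma hook_cell_row_eq i j :
  ((val (hook_cell i)).1 == (val (hook_cell j)).1) = (a - i == a - j)%N.
Proof. by []. Qed.
Lemma hook_cell_col_eq i j :
  ((val (hook_cell i)).2 == (val (hook_cell j)).2) = (i - a == j - a)%N.
Proof. by []. Qed.

Lemma hook_cellK : cancel hook_cell hook_index.
Proof.
move=> i; apply: ord_inj; have lti := ltn_ord i.
by rewrite /hook_index hook_cell_row hook_cell_col inordK; lia.
Qed.

Lemma hook_indexK : cancel hook_index hook_cell.
Proof.
move=> [[r c] /= H]; have := H; rewrite nth_hook => H'.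
have rs : (r <= a)%N by have := ltn_ord r; rewrite [X in (_ < X)%N]size_hook.
have ch : (c <= b)%N by have := ltn_ord c.
have cr : (0 < r)%N -> (c = 0 :> nat) by move: H'; case: (r : nat) => // r';
  case: (r' < a)%N => /= H1 _; [apply/eqP; rewrite -leqn0 -ltnS|].
have E : hook_index (exist _ (r, c) H) =
  (a - r + c)%N :> nat by rewrite /hook_index [X in inord X](_ : _ =
    (a - r + c)%N) // inordK //; lia.
apply: val_inj => /=; congr pair; apply: val_inj; rewrite /= E.
  by case: (posnP r) => [->|/cr ->]; rewrite ?addn0 ?subKn // subn0 subnDA subnn.
by case: (posnP r) => [->|/cr ->]; rewrite ?addn0 ?subn0 ?addKn // subnAC subnn.
Qed.

Lemma schur_hookpoly : schur n k lam = hookpoly n (a + b) a k.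
Proof.
pose h (y : {ffun 'I_(a + b).+1 -> 'I_n}) : {ffun cell lam ->
  'I_n} := [ffun c => y (hook_index c)].
pose g (T : {ffun cell lam -> 'I_n}) : {ffun 'I_(a + b).+1 ->
  'I_n} := [ffun i => T (hook_cell i)].
have hK : cancel h g by move=> y; apply/ffunP => i; rewrite !ffunE hook_cellK.
have gK : cancel g h by move=> T; apply/ffunP => i; rewrite !ffunE hook_indexK.
rewrite /schur (reindex h) /=; last exact/onW_bij/(Bijective hK gK).
apply: eq_big => [y|y _]; last first.
  rewrite (reindex hook_cell) /=; last exact/onW_bij/(Bijective hook_cellK hook_indexK).
  by apply: eq_bigr => i _; rewrite ffunE hook_cellK.
have hy i : h y (hook_cell i) = y i by rewrite ffunE hook_cellK.
apply/and3P/hwordP => [[/forallP H1 /forallP H2 /forallP H3]|[H1 H2 H3]]; split.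
- by move=> i; have := H1 (hook_cell i); rewrite hy.
- move=> i j ij ja; have /forallP /(_ (hook_cell i)) := H3 (hook_cell j); rewrite !hy.
  by rewrite ?hook_cell_row_eq ?hook_cell_col_eq ?hook_cell_row ?hook_cell_col =>
    /implyP; apply; lia.
- move=> i j ij ja; have /forallP /(_ (hook_cell j)) := H2 (hook_cell i); rewrite !hy.
  by rewrite ?hook_cell_row_eq ?hook_cell_col_eq ?hook_cell_row ?hook_cell_col =>
    /implyP; apply; lia.
- by apply/forallP => c; rewrite -(hook_indexK c) hy.
- apply/forallP => c; apply/forallP => c'; rewrite -(hook_indexK c) -(hook_indexK c') !hy.
  by apply/implyP; rewrite ?hook_cell_row_eq ?hook_cell_col_eq ?hook_cell_row
    ?hook_cell_col => H; apply: H3; lia.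
- apply/forallP => c; apply/forallP => c'; rewrite -(hook_indexK c) -(hook_indexK c') !hy.
  by apply/implyP; rewrite ?hook_cell_row_eq ?hook_cell_col_eq ?hook_cell_row
    ?hook_cell_col => H; apply: H2; lia.
Qed.
End HookTableaux.

(** * The hook rule *)

Section Coefficients.
Variable R : comNzRingType.
Notation K := {poly {poly R}}.
Let t : K := 'X%:P.
Let q : K := 'X.

(** The coefficient extraction that turns the weight of a minimal permutation into
    a binomial coefficient. *)
Lemma coef_monomial_binomial D H N a b :
  (t ^+ D * q ^+ H * (t + q) ^+ N)`_a`_b =
  (if (D + H + N == a + b)%N then binz N (Posz (H + N) - Posz a) else 0%N)%:R.
Proof.
have -> : t ^+ D * q ^+ H * (t + q) ^+ N = 'X^H *
    \sum_(i < N.+1) ('X^(D + (N - i)) *+ 'C(N, i))%:P * 'X^i.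
  rewrite exprDn mulr_sumr [RHS]mulr_sumr; apply: eq_bigr => i _.
  rewrite polyCMn rmorphXn /= exprD mulrnAr mulrnAl mulrnAr; congr (_ *+ _).
  by rewrite -/t -/q; ring.
rewrite coefXnM; case: ltnP => aH.
  rewrite !coef0; case: eqP => // E.
  rewrite (_ : Posz (H + N) - Posz a = Posz (H + N - a)); last by lia.
  by rewrite /= bin_small //; lia.
rewrite coef_sum; under eq_bigr do rewrite coefCM coefXn mulr_natr.
case: (leqP (a - H) N) => aN; last first.
  rewrite big1 => [|i _]; last first.
    by rewrite (_ : (a - H == i)%N = false) //; have := ltn_ord i; lia.
  rewrite coef0; case: eqP => // E; have [m ->] : exists m, Posz (H + N) - Posz a = Negz m.
    by exists (a - (H + N)).-1; lia.
  by [].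
rewrite (bigD1 (Ordinal (aN : (a - H < N.+1)%N))) //= eqxx big1 ?addr0; last first.
  by move=> i; rewrite -val_eqE /= eq_sym => /negPf ->.
rewrite coefMn coefMn coefXn (_ : (b == D + (N - (a - H)))%N = (D + H + N == a + b)%N);
  last by lia.
case: eqP => E; last by rewrite !mul0rn.
rewrite (_ : Posz (H + N) - Posz a = Posz (N - (a - H))); last by lia.
by rewrite /= bin_sub.
Qed.
End Coefficients.

Section HookRule.
Variable n : nat.
Notation R := {mpoly int[n]}.
Notation K := {poly {poly R}}.
Implicit Types (u v w z : 'S_n) (x : 'I_n).
Let t : K := 'X%:P.
Let q : K := 'X.
Notation "p =~ r" := (@congr_mod R n (fun i : 'I_n => mesym n int i.+1) p r) (at level 70).

Definition schub : {ffun 'S_n -> K^o} := [ffun u : 'S_n => (schubert u)%:P%:P].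

Definition hookop (k : nat) u : K := peakless_op t q k n schub u.

Lemma dunkl_op_schub x u : dunkl_op x n schub u = (monk x u)%:P%:P.
Proof.
rewrite ffunE /monk !rmorph_sum; apply: eq_bigr => l _.
rewrite gtn_max !ltn_ord !ffunE /covterm !rmorphB /=.
by congr (_ - _); case: ifP => _; rewrite ?ffunE // !polyC0.
Qed.

Lemma peakless_op0 m (f : {ffun 'S_n -> K^o}) : peakless_op t q 0 m f = 0.
Proof.
have b0 m' g : label_op 0 m' g = 0 :> {ffun 'S_n -> K^o}.
  apply/ffunP => u; rewrite label_opE ffunE big1 // => j _.
  by rewrite big_pred0.
by elim: m f => [//|m IH] f; rewrite /= IH !b0 scaler0 !addr0.
Qed.

Lemma hookop_coef k u a b :
  (hookop k u)`_a`_b = \sum_w (peakless_coef t q k n u w)`_a`_b * schubert w.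
Proof.
rewrite /hookop peakless_opE // !coef_sum; apply: eq_bigr => w _.
by rewrite ffunE !coefMC.
Qed.

Lemma hookpoly0 M a : hookpoly n M a 0 = 0.
Proof. by apply: big_pred0 => y; apply/hwordP => -[/(_ ord0)]. Qed.

(** Coefficient of q^a t^b in peakless_op_rec applied to Schubert
    polynomials. *)
Lemma hookop_rec x u a b :
  (hookop x.+1 u)`_a`_b =
    (if b is b'.+1 then \sum_w (peakless_coef t q x.+1 n u w)`_a`_b' * monk x w else 0)
    + (hookop x u)`_a`_b
    + (if a is a'.+1 then \sum_l
         ((if cov u x l then (hookop x (swap u x l))`_a'`_b else 0)
          - (if cov u l x then (hookop x (swap u l x))`_a'`_b else 0)) else 0)
    + (if (a == 0%N) && (b == 0%N) then monk x u else 0).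
Proof.
have e1 (f g : {ffun 'S_n -> K^o}) : (f - t *: g) u = f u - t * g u by rewrite !ffunE.
have e2 (f g h : {ffun 'S_n ->
  K^o}) : (f + q *: g + h) u = f u + q * g u + h u by rewrite !ffunE.
have := congr1 (fun f : {ffun 'S_n -> K^o} => f u) (peakless_op_rec t q x schub (leqnn n)).
rewrite linearB linearZ /= e1 e2 => /(canRL (subrK _)) E.
rewrite {1}/hookop E !coefD -/(hookop x u) dunkl_op_schub !coefC.
rewrite [_ + (t * _)`_a`_b]addrC -!addrA; congr (_ + (_ + (_ + _))).
- rewrite coefCM coefXM; case: b => [//|b] /=.
  rewrite peakless_opE // !coef_sum; apply: eq_bigr => w _.
  by rewrite dunkl_op_schub !coefMC.
- rewrite coefXM; case: a => [|a] /=; first by rewrite coef0.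
  rewrite ffunE !coef_sum; apply: eq_bigr => l _.
  rewrite gtn_max !ltn_ord !ffunE /= !coefB.
  by congr (_ - _); case: ifP; rewrite ?coef0.
- by case: a => [|a]; case: b => [|b]; rewrite /= ?coefC ?coef0.
Qed.

(** By Monk's rule the recursion of the peakless operator becomes, modulo the
    ideal, that of the hook polynomials; induction on k, and for given k on the
    exponent b of t. *)
Lemma hookop_hookpoly k : (k <= n)%N -> forall b a u,
  (hookop k u)`_a`_b =~ hookpoly n (a + b) a k * schubert u.
Proof.
elim: k => [|k IHk] kn.
  move=> b a u; rewrite /hookop peakless_op0 ffunE !coef0 hookpoly0 mul0r;
    exact: congr_mod_refl.
pose x := Ordinal kn; have {}IHk := IHk (ltnW kn).
have Hmonk w : monk x w =~ 'X_x * schubert w := congr_mod_sym (monk_rule w x).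
have Harm a b u : (hookop k.+1 u)`_a`_b =~ hookpoly n (a + b) a k.+1 * schubert u ->
    \sum_w (peakless_coef t q k.+1 n u w)`_a`_b * monk x w =~
    'X_x * hookpoly n (a + b) a k.+1 * schubert u.
  rewrite hookop_coef -mulrA => H; apply: congr_mod_trans (congr_modM 'X_x H).
  rewrite mulr_sumr; apply: congr_mod_sum => w.
  by rewrite mulrCA; apply: congr_modM.
have Hleg a b u : \sum_l
    ((if cov u x l then (hookop x (swap u x l))`_a`_b else 0)
     - (if cov u l x then (hookop x (swap u l x))`_a`_b else 0)) =~
    'X_x * hookpoly n (a + b) a k * schubert u.
  rewrite -mulrA mulrCA; apply: congr_mod_trans (congr_modM _ (Hmonk u)).
  rewrite /monk mulr_sumr; apply: congr_mod_sum => l; rewrite mulrBr.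
  apply: congr_modD; last apply: congr_modN; rewrite /covterm; case: ifP => _;
    by [exact: IHk|rewrite mulr0; exact: congr_mod_refl].
elim=> [|b IHb] a u; rewrite (hookop_rec x); case: a => [|a]; rewrite ?andbF /=.
- rewrite add0r addr0 (hookpoly00 x) mulrDl; apply: congr_modD; last exact: Hmonk.
  exact: (IHk 0%N 0%N u).
- rewrite add0r addr0 addn0 (hookpolyS x (leqnn _)) ltnn addr0 mulrDl.
  apply: congr_modD; first by have := IHk 0%N a.+1 u; rewrite addn0.
  by have := Hleg a 0%N u; rewrite addn0.
- rewrite !addr0 add0n (hookpolyS x (leq0n _)) /= addr0 mulrDl addrC.
  by apply: congr_modD; [exact: (IHk b.+1 0%N u)|exact: (Harm 0%N b u (IHb 0%N u))].
- rewrite addr0 addnS (hookpolyS x) /=; last exact: leqW (leq_addr _ _).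
  rewrite leq_addr /= !mulrDl [X in X + _ =~ _]addrC.
  apply: congr_modD; last by have := Hleg a b.+1 u; rewrite addnS.
  apply: congr_modD; first by have := IHk b.+1 a.+1 u; rewrite addnS.
  exact: Harm (IHb a.+1 u).
Qed.

Lemma peakless_coef_hook k u z a b : (k <= n)%N ->
  (peakless_coef t q k n u (permcomp z u))`_a`_b * schubert (permcomp z u) =
  if [&& pminimal z, kbruhat k u (permcomp z u) & kheight z == (a.+1 + b.+1 - 1)%N]
  then schubert (permcomp z u) *+ binz (pcycles z - 1) (Posz (pht z) - Posz a.+1) else 0.
Proof.
move=> kn; have zE : (u^-1 * permcomp z u)%g = z by rewrite /permcomp mulKg.
rewrite /peakless_coef minimal_pair_full zE; case: (boolP (kbruhat k u _)) => kb; last first.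
  by rewrite !coef0 mul0r andbF.
rewrite (pminimalE kn kb) /=; case: eqP => mz /=; last by rewrite !coef0 mul0r.
have hE : kheight z = (#|psupp z| - pcycles z)%N.
  have := kheightE kn kb; have := pcycles_pdown z; rewrite mz /rank2; lia.
have d1 := pcycles_pdown z; have d2 := pcycles_pht z.
rewrite hE /peakless_weight; case: (eqVneq z 1%g) => [->|z1].
  rewrite !coef0 mul0r psupp1 pcycles1; case: eqP => //; lia.
have s0 := pcycles_gt0 z1.
rewrite coef_monomial_binomial.
have -> : (#|psupp z| - pht z - pcycles z + (pht z - pcycles z) + (pcycles z).-1 == a + b)%N =
   (#|psupp z| - pcycles z == a.+1 + b.+1 - 1)%N by lia.
case: eqP => E; last by rewrite mul0r.
rewrite mulr_natl -subn1; congr (_ *+ binz _ _); lia.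
Qed.

End HookRule.

Theorem proposition2p5 (n k a b : nat)
    (hn : (0 < n)%N) (hk : (0 < k)%N) (ha : (0 < a)%N) (hb : (0 < b)%N)
    (u : 'S_n) (hak : (a <= k)%N) (hbk : (b <= n - k)%N) :
  eq_flag
    (schubert u * schur n k (hook a b))
    (\sum_(z : 'S_n | [&& pminimal z, kbruhat k u (permcomp z u)
                        & kheight z == (a + b - 1)%N])
        schubert (permcomp z u) *+ binz (pcycles z - 1) (Posz (pht z) - Posz a)).
Proof.
case: a ha hak => // a _ _; case: b hb hbk => // b _ hbk.
have kn : (k <= n)%N by lia.
have -> : schubert u * schur n k (hook a.+1 b.+1) = hookpoly n (a + b) a k * schubert u.
  by rewrite mulrC schur_hookpoly.
apply: congr_mod_trans (congr_mod_sym (hookop_hookpoly kn b a u)) _.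
rewrite hookop_coef (reindex_inj (mulgI u)) [X in congr_mod _ _ X]big_mkcond /=.
apply: congr_mod_sum => z; rewrite -[(u * z)%g]/(permcomp z u) peakless_coef_hook //.
exact: congr_mod_refl.
Qed.
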